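(* Let $p\ge2$ and $0<a<b<\beta_p$. For every $\varepsilon>0$ there exists a constant $K>0$ such that for all $\beta\in[a,b]$ and all $N\ge1$, $$\mathbb E\big\langle 1\{|R_{1,2}|\ge\varepsilon\}\big\rangle_\beta\le K\exp(-N/K).$$
   Context: $\Sigma_N=\{-1,1\}^N$, $(g_{i_1,\dots,i_p})$ i.i.d. standard Gaussians, $H_N(\sigma)=N^{-(p-1)/2}\sum_{1\le i_1,\dots,i_p\le N}g_{i_1,\dots,i_p}\sigma_{i_1}\cdots\sigma_{i_p}$, $F_N(\beta)=\frac1N\log\sum_{\sigma}2^{-N}\exp(\tfrac{\beta}{\sqrt2}H_N(\sigma))$, which converges a.s. to a nonrandom $F(\beta)\le\beta^2/4$. $\mathcal R=\{\beta>0:F(\beta)=\beta^2/4\}$, $\beta_p=\max\mathcal R$. The Gibbs measure is $G_{N,\beta}(\sigma)\propto\exp(\tfrac{\beta}{\sqrt2}H_N(\sigma))$ on $\Sigma_N$; $\langle\cdot\rangle_\beta$ is the average with respect to $G_{N,\beta}^{\otimes2}$ over two independent samples $\sigma^1,\sigma^2$, and $R_{1,2}=\frac1N\sum_{i=1}^N\sigma^1_i\sigma^2_i$ is their overlap. $\mathbb E$ is expectation over the disorder $g$. *)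

(* Defs.v *)
From HB Require Import structures.
From mathcomp Require Import all_boot all_order all_algebra.
From mathcomp Require Import all_classical all_reals all_analysis.
Unset Strict Implicit. Unset Printing Implicit Defensive.
Import Order.TTheory GRing.Theory Num.Theory.
Import numFieldNormedType.Exports.
Local Open Scope classical_set_scope.
Local Open Scope ring_scope.

(* Multi-indices (i_1,...,i_p) of the infinite disorder array. *)
Definition midx (p : nat) := {ffun 'I_p -> nat}.

Definition config (N : nat) := {ffun 'I_N -> bool}.
Definition spin {R : realType} {N} (s : config N) (i : 'I_N) : R :=
  if s i then 1 else -1.

Definition iid_std_gaussian {d} {T : measurableType d} {R : realType}
  (P : probability T R) {I : choiceType} (g : I -> T -> R) : Prop :=
  (forall i, measurable_fun setT (g i)) /\
  (forall i (B : set R), measurable B -> P (g i @^-1` B) = normal_prob 0 1 B) /\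
  (forall (J : seq I) (B : I -> set R), uniq J -> (forall j, measurable (B j)) ->
     P (\bigcap_(j in [set j | j \in J]) (g j @^-1` B j))
     = (\prod_(j <- J) P (g j @^-1` B j))%E).

Definition hamiltonian {T} {R : realType} (p N : nat) (g : midx p -> T -> R)
  (w : T) (s : config N) : R :=
  (N%:R `^ (- ((p%:R - 1) / 2))) *
  \sum_(i : {ffun 'I_p -> 'I_N})
     g [ffun k => nat_of_ord (i k)] w * \prod_(k < p) spin s (i k).

Definition gibbs_weight {T} {R : realType} (p N : nat) (g : midx p -> T -> R)
  (beta : R) (w : T) (s : config N) : R :=
  expR (beta / Num.sqrt 2 * hamiltonian p N g w s).

Definition free_energy {T} {R : realType} (p N : nat) (g : midx p -> T -> R)
  (beta : R) (w : T) : R :=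
  N%:R^-1 * ln (\sum_(s : config N) (2 ^- N) * gibbs_weight p N g beta w s).

Definition overlap {R : realType} {N} (s1 s2 : config N) : R :=
  N%:R^-1 * \sum_(i < N) spin s1 i * spin s2 i.

Definition gibbs_overlap_tail {T} {R : realType} (p N : nat)
  (g : midx p -> T -> R) (beta eps : R) (w : T) : R :=
  (\sum_(s1 : config N) \sum_(s2 : config N)
     (if eps <= `|overlap s1 s2| then 1 else 0) *
     gibbs_weight p N g beta w s1 * gibbs_weight p N g beta w s2)
  / (\sum_(s : config N) gibbs_weight p N g beta w s) ^+ 2.

Definition RS_set {R : realType} (F : R -> R) : set R :=
  [set beta | 0 < beta /\ F beta = beta ^+ 2 / 4].

(* beta_p = max R (taken as the supremum of R) *)
Definition beta_crit {R : realType} (F : R -> R) : R := sup (RS_set F).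

(* Main.v *)
Require Import Defs.
From HB Require Import structures.
From mathcomp Require Import all_boot all_order all_algebra.
From mathcomp Require Import all_classical all_reals all_analysis.
From mathcomp Require Import measurable_realfun ring lra.
Import Order.TTheory GRing.Theory Num.Theory.
Import numFieldNormedType.Exports.
Local Open Scope classical_set_scope.
Local Open Scope ring_scope.

(** Let [x = R_{1,2}^p] and let [Z] be the partition function divided by its
    mean. Fix [b0] in the replica symmetric set with [b < b0].

    - The free energy is Lipschitz in each coupling, so it concentrates at
      exponential speed; with the monotonicity of [E log Z] in beta (integration
      by parts) this gives [P (Z <= e^{-tN}) <= e^{-cN}] for all [beta <= b0].
    - Tilting the disorder by [Z] plants a configuration: by gauge symmetry it
      amounts to shifting all couplings by a constant, which turns [Z] into a
      sum [Zp] whose terms are biased by [exp (N beta^2 x / 2)]. If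
      [E log Zp >= tN], then [Z] would be exponentially large for typical Gibbs
      samples under the original disorder, against Markov's inequality; hence
      [E log Zp = o(N)] for every [beta <= b0].
    - Let [Zp_m] be the part of [Zp] with [x >= m] and suppose that overlaps
      [x >= m + eta] are already known to be exponentially unlikely. If
      [E log Zp_m] were not [<= -cN], two replicas of the [m]-layer would have
      [x <= m + eta], and convexity in beta with integration by parts would
      make [E log Zp_m] grow by at least [h beta (m - eta) N / 2 - O(h^2) N]
      between [beta] and [beta + h <= b0], against the previous point. Hence
      [x >= m] is exponentially unlikely, and one descends from [m > 1] to any
      [m > 0].
    - Negative values of [x] are excluded by the second moment
      [E W(s) W(t) = exp (N beta^2 x / 2)]. *)

(** * The standard normal law on R *)

(** Nothing is differentiated in beta: [Ex_lnSw_convex] combines convexity and integration by parts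
    over a finite increment. It serves the upward step for a layer and, with an error quadratic in
    the step, the downward monotonicity of [E log Z]. A layer grows because of a balance: in units
    of [h * b * V / 2] the planted bias brings [2 m], while the replica term takes back at most
    [m + eta + Q], with [Q] the mean weight of pairs of replicas that are too close. The obstacle is
    to bound [Q]: these replicas come from one layer under planted disorder, whereas the known
    estimate concerns the original Gibbs measure. Passing from one to the other costs a factor
    [y2^3 / y1^2], that is [exp (10 c N)] for thresholds [exp (2 c N)] and [exp (- 2 c N)]. It is
    affordable because the known estimate is exponential and [c] is small against its rate; hence
    the descent must carry exponential bounds, with a rate that may shrink at each level. As all
    levels satisfy [m >= x0], the level step [x0 / 4] and the increment [h] are the same throughout,
    and finitely many steps suffice. *)

Lemma ge0_integral_image_measure d1 d2 (T1 : measurableType d1)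
    (T2 : measurableType d2) (R : realType) (m1 : {measure set T1 -> \bar R})
    (m2 : {measure set T2 -> \bar R}) (phi : T1 -> T2) (f : T2 -> \bar R) :
  measurable_fun setT phi ->
  (forall A, measurable A -> m1 (phi @^-1` A) = m2 A) ->
  measurable_fun setT f -> (forall x, 0 <= f x)%E ->
  (\int[m1]_x f (phi x) = \int[m2]_y f y)%E.
Proof.
move=> mphi m12 mf f0.
pose phi' : {mfun T1 >-> T2} := HB.pack phi (isMeasurableFun.Build _ _ _ _ _ mphi).
rewrite [RHS](eq_measure_integral (pushforward m1 phi')); last first.
  by move=> A mA _; rewrite -m12.
by rewrite [RHS]ge0_integral_pushforward ?preimage_setT.
Qed.

(* [normal_prob] lives on [measurableTypeR R], whose display differs from the
   one of the canonical [measurableType] on [R]; [stdnormal] is the same measure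
   on the latter. *)
Definition stdnormal (R : realType) (A : set R) : \bar R := normal_prob 0 1 A.

Section stdnormal_measure.
Context {R : realType}.

Let stdnormal0 : stdnormal R set0 = 0%E.
Proof. exact: measure0. Qed.

Let stdnormal_ge0 (A : set R) : (0 <= stdnormal R A)%E.
Proof. exact: measure_ge0. Qed.

Let stdnormal_sigma_additive :
  @semi_sigma_additive _ R R (stdnormal R).
Proof. exact: (@measure_semi_sigma_additive _ _ _ (@normal_prob R 0 1)). Qed.

HB.instance Definition _ := isMeasure.Build _ R R (stdnormal R)
  stdnormal0 stdnormal_ge0 stdnormal_sigma_additive.

Let stdnormal_setT : stdnormal R setT = 1%E.
Proof. exact: (@probability_setT _ _ _ (@normal_prob R 0 1)). Qed.

HB.instance Definition _ :=
  Measure_isProbability.Build _ R R (stdnormal R) stdnormal_setT.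

End stdnormal_measure.

Section gauss1.
Context {R : realType}.
Notation mu := (@lebesgue_measure R).
Notation gamma := (stdnormal R).
Notation pdf := (@normal_pdf R 0 1).

Lemma lebesgue_measure_shift (t : R) (A : set R) : measurable A ->
  pushforward mu ((fun x => x + t) : _ -> measurableTypeR R) A = mu A.
Proof.
move=> mA; apply/esym/lebesgue_measure_unique => //=.
  by exact: measurable_funD.
move=> ? _ [[a b]] _ <-.
rewrite /pushforward (_ : _ @^-1` _ = `]a - t, b - t]%classic); last first.
  by apply/seteqP; split => x /=; rewrite !in_itv/= ltrBlDr lerBrDr.
rewrite !lebesgue_measure_itv/= !lte_fin ltrD2r; case: ifP => // _.
by rewrite -!EFinD; congr EFin; lra.
Qed.

(** The change of variables is done with the Radon-Nikodym derivative, which agrees almost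
    everywhere with [pdf] since both have the same integral over every measurable set. *)
Lemma integral_stdnormalE (f : R -> \bar R) : measurable_fun setT f ->
  (forall x, 0 <= f x)%E ->
  (\int[gamma]_x f x = \int[mu]_x (f x * (pdf x)%:E))%E.
Proof.
move=> mf f0.
rewrite -(@ge0_integral_image_measure _ _ (measurableTypeR R) R _
  (@normal_prob R 0 1) gamma idfun)//=.
have dom := @normal_prob_dominates R 0 1.
rewrite -(Radon_Nikodym_SigmaFinite.change_of_variables dom)//.
have mRN : mu.-integrable setT
    (Radon_Nikodym_SigmaFinite.f (@normal_prob R 0 1) mu).
  exact: Radon_Nikodym_SigmaFinite.f_integrable.
apply: ae_eq_integral => //.
- by apply: emeasurable_funM => //; exact: measurable_int mRN.
- apply: emeasurable_funM => //.
  by apply/measurable_EFinP; exact: measurable_normal_pdf.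
- apply: ae_eqe_mul2l; apply: integral_ae_eq => //.
    by apply/measurable_EFinP; exact: measurable_normal_pdf.
  by move=> E _ mE; rewrite -Radon_Nikodym_SigmaFinite.f_integral.
- exact: (@measurable_id _ (measurableTypeR R)).
Qed.

Lemma normal_pdf_shift (t x : R) :
  pdf (x - t) = pdf x * expR (t * x - t ^+ 2 / 2).
Proof.
rewrite !normal_pdfE ?oner_eq0// /normal_fun -mulrA -expRD; congr (_ * expR _).
by field.
Qed.

(** One-dimensional Cameron-Martin formula: translation invariance of Lebesgue measure turns the
    shift into the density ratio of [normal_pdf_shift]. *)
Lemma integral_stdnormal_shift (f : R -> \bar R) (t : R) : measurable_fun setT f ->
  (forall x, 0 <= f x)%E ->
  (\int[gamma]_x f (x + t)%R
   = \int[gamma]_x (f x * (expR (t * x - t ^+ 2 / 2))%:E))%E.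
Proof.
move=> mf f0.
have mD : measurable_fun setT (fun x : R => x + t) by exact: measurable_funD.
have mf1 : measurable_fun setT (fun x : R => f (x + t)) by exact: measurableT_comp.
rewrite integral_stdnormalE// [RHS]integral_stdnormalE//; last 2 first.
- apply: emeasurable_funM => //; apply/measurable_EFinP.
  apply: measurableT_comp => //; apply: measurable_funB => //. 
- by move=> x; rewrite mule_ge0// lee_fin expR_ge0.
rewrite -(@ge0_integral_image_measure _ _ _ _ _ mu mu (fun x : R => x + t)
  (fun x => f x * (expR (t * x - t ^+ 2 / 2))%:E * (pdf x)%:E)%E mD).
- apply: eq_integral => x _.
  rewrite -muleA -EFinM [in expR _ * _]mulrC -normal_pdf_shift addrK //.
- by move=> A mA; exact: lebesgue_measure_shift.
- apply: emeasurable_funM => //; last first.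
    by apply/measurable_EFinP; exact: measurable_normal_pdf.
  apply: emeasurable_funM => //; apply/measurable_EFinP.
  by apply: measurableT_comp => //; exact: measurable_funB.
- by move=> x; rewrite !mule_ge0// lee_fin ?expR_ge0 ?normal_pdf_ge0.
Qed.

Lemma integral_stdnormal_opp (f : R -> \bar R) : measurable_fun setT f ->
  (forall x, 0 <= f x)%E ->
  (\int[gamma]_x f (- x)%R = \int[gamma]_x f x)%E.
Proof.
move=> mf f0.
have mf1 : measurable_fun setT (fun x : R => f (- x)) by exact: measurableT_comp.
rewrite integral_stdnormalE// [RHS]integral_stdnormalE//.
have mN : measurable_fun setT (-%R : R -> R) by [].
rewrite -(@ge0_integral_image_measure _ _ _ _ _ mu mu (-%R : R -> R)
  (fun x => f x * (pdf x)%:E)%E mN).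
- apply: eq_integral => x _; congr (_ * _%:E)%E.
  by rewrite !normal_pdfE ?oner_eq0// /normal_fun !subr0 sqrrN.
- by move=> A mA; exact: lebesgue_measureN.
- apply: emeasurable_funM => //; apply/measurable_EFinP.
  exact: measurable_normal_pdf.
- by move=> x; rewrite mule_ge0// lee_fin normal_pdf_ge0.
Qed.

End gauss1.

(** * Gaussian vectors *)

(** The display of a product is built from those of its factors, so it follows the same recursion as
    [vec]. Nested pairs let Tonelli drive every induction on [n]. *)
Fixpoint vec_display (n : nat) : measure_display :=
  match n with
  | 0 => default_measure_display
  | n'.+1 => measure_prod_display (default_measure_display, vec_display n')
  end.

Fixpoint vec (R : realType) (n : nat) : measurableType (vec_display n) :=
  match n return measurableType (vec_display n) with
  | 0 => unit
  | n'.+1 => (R * vec R n')%type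
  end.

Section vec.
Context {R : realType}.

Fixpoint gauss (n : nat) : probability (vec R n) R :=
  match n return probability (vec R n) R with
  | 0 => dirac (tt : vec R 0)
  | n'.+1 => (stdnormal R \x gauss n')%E
  end.

(** Indexing by [nat] instead of ordinals makes passing to the tail of a vector a mere composition
    with [S]. *)
Fixpoint crd n : vec R n -> nat -> R :=
  match n return vec R n -> nat -> R with
  | 0 => fun _ _ => 0
  | n'.+1 => fun v k => if k is k'.+1 then crd n' v.2 k' else v.1
  end.

Fixpoint mkvec n (u : nat -> R) : vec R n :=
  match n return vec R n with
  | 0 => tt
  | n'.+1 => (u 0, mkvec n' (u \o S))
  end.

Fixpoint l1 n : vec R n -> R :=
  match n return vec R n -> R with
  | 0 => fun=> 0
  | n'.+1 => fun v => `|v.1| + l1 n' v.2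
  end.

Fixpoint vshift n (u : nat -> R) : vec R n -> vec R n :=
  match n return vec R n -> vec R n with
  | 0 => id
  | n'.+1 => fun v => (v.1 + u 0, vshift n' (u \o S) v.2)
  end.

Fixpoint vscale n (u : nat -> R) : vec R n -> vec R n :=
  match n return vec R n -> vec R n with
  | 0 => id
  | n'.+1 => fun v => (u 0 * v.1, vscale n' (u \o S) v.2)
  end.

Lemma crd_mkvec n u k : (k < n)%N -> crd n (mkvec n u) k = u k.
Proof. by elim: n u k => // n IH u [|k] //= kn; rewrite IH. Qed.

Lemma crd_vshift n u v k : (k < n)%N -> crd n (vshift n u v) k = crd n v k + u k.
Proof. by elim: n u v k => // n IH u v [|k] //= kn; rewrite IH. Qed.

Lemma crd_vscale n u v k : (k < n)%N -> crd n (vscale n u v) k = u k * crd n v k.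
Proof. by elim: n u v k => // n IH u v [|k] //= kn; rewrite IH. Qed.

Lemma l1E n v : l1 n v = \sum_(k < n) `|crd n v k|.
Proof.
elim: n v => [|n IH] v; first by rewrite big_ord0.
by rewrite big_ord_recl /= IH.
Qed.

Lemma l1_ge0 n v : 0 <= l1 n v.
Proof. by rewrite l1E sumr_ge0. Qed.

Lemma measurable_crd n k : measurable_fun setT (crd n ^~ k).
Proof.
elim: n k => [|n IH] [|k] /=; try exact: measurable_cst.
  exact: measurable_fst.
exact: (measurableT_comp (IH k) measurable_snd).
Qed.

Lemma measurable_l1 n : measurable_fun setT (l1 n).
Proof.
rewrite (_ : l1 n = (fun v => \sum_(k < n) `|crd n v k|)); last first.
  by apply/funext => v; rewrite l1E.
apply: measurable_sum => k; apply: measurableT_comp => //.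
exact: measurable_crd.
Qed.

Lemma measurable_vshift n u : measurable_fun setT (vshift n u).
Proof.
elim: n u => [|n IH] u /=; first exact: measurable_id.
apply: measurable_fun_pair; first exact: measurable_funD.
exact: (measurableT_comp (IH _) measurable_snd).
Qed.

Lemma measurable_vscale n u : measurable_fun setT (vscale n u).
Proof.
elim: n u => [|n IH] u /=; first exact: measurable_id.
apply: measurable_fun_pair; first exact: measurable_funM.
exact: (measurableT_comp (IH _) measurable_snd).
Qed.

(** Induction by Tonelli: for a fixed head the tail is shifted by the induction hypothesis, then the
    head by the one-dimensional formula, and the exponential factors multiply. *)
Lemma integral_gauss_shift n u (f : vec R n -> \bar R) :
  measurable_fun setT f -> (forall v, 0 <= f v)%E ->
  (\int[gauss n]_v f (vshift n u v) = \int[gauss n]_v (f v *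
    (expR (\sum_(k < n) (u k * crd n v k - u k ^+ 2 / 2)))%:E))%E.
Proof.
elim: n u f => [|n IH] u f mf f0.
  by apply: eq_integral => v _; rewrite big_ord0 expR0 mule1.
have mF (w : nat -> R) m : measurable_fun setT (fun v : vec R m =>
    (expR (\sum_(k < m) (w k * crd m v k - w k ^+ 2 / 2)))%:E).
  apply/measurable_EFinP; apply: measurableT_comp => //.
  apply: measurable_sum => k; apply: measurable_funB => //.
  by apply: measurable_funM => //; exact: measurable_crd.
have ms1 : measurable_fun setT (vshift n.+1 u) by exact: measurable_vshift.
pose w := u \o S.
pose e v : \bar R := (expR (\sum_(k < n) (w k * crd n v k - w k ^+ 2 / 2)))%:E.
pose h (z : R * vec R n) : \bar R := (f z * e z.2)%E.
have mh : measurable_fun setT h.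
  apply: emeasurable_funM => //.
  exact: (measurableT_comp (mF w n) measurable_snd).
have h0 z : (0 <= h z)%E by rewrite mule_ge0// lee_fin expR_ge0.
have mf1 x : measurable_fun setT (fun y : vec R n => f (x, y)).
  exact: (measurableT_comp mf (pair1_measurable x)).
have mh1 x : measurable_fun setT (fun y : vec R n => h (x, y)).
  exact: (measurableT_comp mh (pair1_measurable x)).
rewrite /= fubini_tonelli1//; last exact: measurableT_comp.
rewrite [RHS]fubini_tonelli1//; last 2 first.
- by apply: emeasurable_funM => //; exact: (mF u n.+1).
- by move=> z; rewrite mule_ge0// lee_fin expR_ge0.
rewrite /fubini_F /=.
transitivity (\int[stdnormal R]_x (fubini_F (gauss n) h (x + u 0))%R)%E.
  apply: eq_integral => x _; rewrite /fubini_F.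
  exact: (IH w (fun y => f (x + u 0, y))).
rewrite (integral_stdnormal_shift (fubini_F (gauss n) h)); last 2 first.
- exact: measurable_fun_fubini_tonelli_F.
- by move=> x; exact: integral_ge0.
apply: eq_integral => x _; rewrite /fubini_F -ge0_integralZr//.
apply: eq_integral => y _; rewrite /h /= -muleA; congr (_ * _)%E.
by rewrite /e -EFinM -expRD big_ord_recl /= addrC.
Qed.

(** Every coordinate has an even law. This is the source of the gauge symmetry of the disorder. *)
Lemma integral_gauss_sign n u (f : vec R n -> \bar R) :
  (forall k, (k < n)%N -> u k = 1 \/ u k = -1) ->
  measurable_fun setT f -> (forall v, 0 <= f v)%E ->
  (\int[gauss n]_v f (vscale n u v) = \int[gauss n]_v f v)%E.
Proof.
elim: n u f => [|n IH] u f us mf f0; first by [].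
have ms1 : measurable_fun setT (vscale n.+1 u) by exact: measurable_vscale.
have mf1 x : measurable_fun setT (fun y : vec R n => f (x, y)).
  exact: (measurableT_comp mf (pair1_measurable x)).
rewrite /= fubini_tonelli1//; last exact: measurableT_comp.
rewrite [RHS]fubini_tonelli1// /fubini_F /=.
transitivity (\int[stdnormal R]_x (fubini_F (gauss n) f (u 0 * x))%R)%E.
  apply: eq_integral => x _; rewrite /fubini_F.
  by apply: (IH _ (fun y => f (u 0 * x, y))) => // k kn; exact: (us k.+1).
case: (us 0 isT) => ->.
  by apply: eq_integral => x _; rewrite mul1r.
rewrite -(@integral_stdnormal_opp _ (fubini_F (gauss n) f)); last 2 first.
- exact: measurable_fun_fubini_tonelli_F.
- by move=> x; exact: integral_ge0.
by apply: eq_integral => x _; rewrite mulN1r.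
Qed.

End vec.

(** * Integrable functions of a Gaussian vector *)

Section tame.
Context {R : realType}.

Lemma integral_stdnormal_expR (t : R) :
  (\int[stdnormal R]_x (expR (t * x))%:E = (expR (t ^+ 2 / 2))%:E)%E.
Proof.
have me : measurable_fun setT (fun x : R => (expR (t * x))%:E).
  by apply/measurable_EFinP; apply: measurableT_comp => //; exact: measurable_funM.
have := @integral_stdnormal_shift R (cst 1%E) t (measurable_cst _) (fun=> lee01).
rewrite integral_cst//= probability_setT mule1.
under eq_integral do rewrite mul1e expRD EFinM.
rewrite ge0_integralZr//.
move=> /(congr1 (fun z => z * (expR (t ^+ 2 / 2))%:E))%E.
by rewrite mul1e -muleA -EFinM -expRD addNr expR0 mule1.
Qed.

Lemma expR_norm_le (b x : R) : expR (b * `|x|) <= expR (b * x) + expR (- b * x).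
Proof.
case: (ger0P x) => x0; first by rewrite lerDl expR_ge0.
by rewrite mulrN mulNr lerDr expR_ge0.
Qed.

Lemma integral_stdnormal_exp_norm (b : R) :
  (\int[stdnormal R]_x (expR (b * `|x|))%:E <= (2 * expR (b ^+ 2 / 2))%:E)%E.
Proof.
have me t : measurable_fun setT (fun x : R => (expR (t * x))%:E).
  by apply/measurable_EFinP; apply: measurableT_comp => //; exact: measurable_funM.
apply: (@le_trans _ _
  (\int[stdnormal R]_x ((expR (b * x))%:E + (expR (- b * x))%:E))%E).
  apply: ge0_le_integral => //.
  - apply/measurable_EFinP; apply: measurableT_comp => //.
    by apply: measurable_funM => //; exact: measurableT_comp.
  - exact: emeasurable_funD.
  - by move=> x _; rewrite -EFinD lee_fin expR_norm_le.
rewrite ge0_integralD//; try by move=> x _; rewrite lee_fin expR_ge0.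
by rewrite !integral_stdnormal_expR -EFinD lee_fin sqrrN mulr_natl mulr2n.
Qed.

(** By independence the moment factorizes over the coordinates. Its finiteness is what makes [tame]
    functions integrable. *)
Lemma integral_gauss_exp_l1 n (b : R) :
  (\int[gauss n]_v (expR (b * l1 n v))%:E
    <= ((2 * expR (b ^+ 2 / 2)) ^+ n)%:E)%E.
Proof.
elim: n => [|n IH].
  rewrite (eq_integral (cst 1%:E)); last by move=> v _; rewrite /= mulr0 expR0.
  by rewrite integral_cst// mul1e -[leRHS](probability_setT (gauss 0)) le_refl.
have ml m : measurable_fun setT (fun v : vec R m => (expR (b * l1 m v))%:E).
  apply/measurable_EFinP; apply: measurableT_comp => //.
  by apply: measurable_funM => //; exact: measurable_l1.
have m1 : measurable_fun setT (fun x : R => (expR (b * `|x|))%:E).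
  apply/measurable_EFinP; apply: measurableT_comp => //.
  by apply: measurable_funM => //; exact: measurableT_comp.
rewrite /= fubini_tonelli1//; last exact: (ml n.+1).
rewrite /fubini_F /=.
apply: (@le_trans _ _ (\int[stdnormal R]_x ((expR (b * `|x|))%:E *
    ((2 * expR (b ^+ 2 / 2)) ^+ n)%:E))%E).
  apply: ge0_le_integral => //=.
  - by move=> x _; exact: integral_ge0.
  - exact: (measurable_fun_fubini_tonelli_F _ (ml n.+1)).
  - exact: emeasurable_funM.
  - move=> x _; under eq_integral do rewrite mulrDr expRD EFinM.
    by rewrite ge0_integralZl//; apply: lee_pmul => //; exact: integral_ge0.
rewrite ge0_integralZr//.
rewrite (exprS _ n) EFinM; apply: lee_pmul => //; first exact: integral_ge0.
exact: integral_stdnormal_exp_norm.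
Qed.

(* At most exponential growth in the l1 norm: stable under sums, products and
   shifts, and enough for integrability. *)
Definition tame n (f : vec R n -> R) := measurable_fun setT f /\
  exists a b : R, forall v, `|f v| <= a * expR (b * l1 n v).

Definition tame1 (f : R -> R) := measurable_fun setT f /\
  exists a b : R, forall x, `|f x| <= a * expR (b * `|x|).

Lemma integrable_tame n (f : vec R n -> R) : tame n f ->
  (gauss n).-integrable setT (EFin \o f).
Proof.
move=> [mf [a [b fab]]]; apply/integrableP; split; first exact/measurable_EFinP.
have ml m : measurable_fun setT (fun v : vec R m => (expR (b * l1 m v))%:E).
  apply/measurable_EFinP; apply: measurableT_comp => //.
  by apply: measurable_funM => //; exact: measurable_l1.
apply: (@le_lt_trans _ _ (\int[gauss n]_v ((`|a|)%:E * (expR (b * l1 n v))%:E))%E).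
  apply: ge0_le_integral => //.
  - by apply: measurableT_comp => //; exact/measurable_EFinP.
  - exact: emeasurable_funM.
  - move=> v _; rewrite -EFinM lee_fin /=; apply: le_trans (fab v) _.
    by rewrite ler_wpM2r ?expR_ge0// ler_norm.
rewrite ge0_integralZl//.
apply: lte_mul_pinfty; rewrite ?lee_fin//.
exact: le_lt_trans (integral_gauss_exp_l1 n b) (ltry _).
Qed.

Lemma integrable_tame1 (f : R -> R) : tame1 f ->
  (stdnormal R).-integrable setT (EFin \o f).
Proof.
move=> [mf [a [b fab]]]; apply/integrableP; split; first exact/measurable_EFinP.
have m1 : measurable_fun setT (fun x : R => (expR (b * `|x|))%:E).
  apply/measurable_EFinP; apply: measurableT_comp => //.
  by apply: measurable_funM => //; exact: measurableT_comp.
apply: (@le_lt_trans _ _ (\int[stdnormal R]_v ((`|a|)%:E * (expR (b * `|v|))%:E))%E).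
  apply: ge0_le_integral => //.
  - by apply: measurableT_comp => //; exact/measurable_EFinP.
  - exact: emeasurable_funM.
  - move=> v _; rewrite -EFinM lee_fin /=; apply: le_trans (fab v) _.
    by rewrite ler_wpM2r ?expR_ge0// ler_norm.
rewrite ge0_integralZl//.
apply: lte_mul_pinfty; rewrite ?lee_fin//.
exact: le_lt_trans (integral_stdnormal_exp_norm b) (ltry _).
Qed.

Lemma tame_bnd n (f : vec R n -> R) (c : R) : measurable_fun setT f ->
  (forall v, `|f v| <= c) -> tame n f.
Proof.
move=> mf fc; split => //; exists c, 0 => v.
by rewrite mul0r expR0 mulr1.
Qed.

Lemma tame_cst n (c : R) : tame n (fun=> c).
Proof. by apply: (@tame_bnd _ _ `|c|). Qed.

Lemma ler_pM_expR (a b c l : R) : 0 <= l -> `|b| <= c ->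
  a * expR (b * l) <= `|a| * expR (c * l).
Proof.
move=> l0 bc; apply: (@le_trans _ _ (`|a| * expR (b * l))).
  by rewrite ler_wpM2r ?expR_ge0// ler_norm.
rewrite ler_wpM2l// ler_expR ler_wpM2r//; apply: le_trans bc; exact: ler_norm.
Qed.

Lemma tameD n (f g : vec R n -> R) : tame n f -> tame n g ->
  tame n (fun v => f v + g v).
Proof.
move=> [mf [a [b fab]]] [mg [a' [b' gab]]]; split; first exact: measurable_funD.
exists (`|a| + `|a'|), (`|b| + `|b'|) => v; have l0 := l1_ge0 n v.
apply: le_trans (ler_normD _ _) _; rewrite mulrDl; apply: lerD.
  by apply: le_trans (fab v) _; apply: ler_pM_expR; rewrite ?lerDl.
by apply: le_trans (gab v) _; apply: ler_pM_expR; rewrite ?lerDr.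
Qed.

Lemma tameM n (f g : vec R n -> R) : tame n f -> tame n g ->
  tame n (fun v => f v * g v).
Proof.
move=> [mf [a [b fab]]] [mg [a' [b' gab]]]; split; first exact: measurable_funM.
exists (a * a'), (b + b') => v.
rewrite normrM mulrDl expRD mulrACA.
exact: ler_pM.
Qed.

Lemma tameZ n (c : R) (f : vec R n -> R) : tame n f -> tame n (fun v => c * f v).
Proof. by apply: tameM; exact: tame_cst. Qed.

Lemma tameN n (f : vec R n -> R) : tame n f -> tame n (fun v => - f v).
Proof.
move=> tf; rewrite (_ : (fun _ => _) = (fun v => -1 * f v)); first exact: tameZ.
by apply/funext => v; rewrite mulN1r.
Qed.

Lemma tameB n (f g : vec R n -> R) : tame n f -> tame n g ->
  tame n (fun v => f v - g v).
Proof. by move=> tf tg; apply: tameD => //; exact: tameN. Qed.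

Lemma tame_sum n (I : Type) (r : seq I) (P : pred I) (f : I -> vec R n -> R) :
  (forall i, P i -> tame n (f i)) -> tame n (fun v => \sum_(i <- r | P i) f i v).
Proof.
move=> tf; elim: r => [|i r IH].
  rewrite (_ : (fun _ => _) = fun=> 0); first exact: tame_cst.
  by apply/funext => v; rewrite big_nil.
case: (boolP (P i)) => Pi; last first.
  by rewrite (_ : (fun _ => _) = (fun v => \sum_(i <- r | P i) f i v))//;
    apply/funext => v; rewrite big_cons (negbTE Pi).
rewrite (_ : (fun _ => _) = (fun v => f i v + \sum_(i <- r | P i) f i v)).
  by apply: tameD => //; exact: tf.
by apply/funext => v; rewrite big_cons Pi.
Qed.

Lemma tame_crd n k : (k < n)%N -> tame n (crd n ^~ k).
Proof.
move=> kn; split; first exact: measurable_crd.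
exists 1, 1 => v; rewrite !mul1r.
apply: (@le_trans _ _ (1 + l1 n v)); last exact: expR_ge1Dx.
rewrite l1E (bigD1 (Ordinal kn))//= addrCA lerDl addr_ge0// sumr_ge0//.
Qed.

Definition Ex n (f : vec R n -> R) : R := \int[gauss n]_v f v.
Definition E1 (f : R -> R) : R := \int[stdnormal R]_x f x.

Lemma Ex_EFin n (f : vec R n -> R) : tame n f ->
  ((Ex n f)%:E = \int[gauss n]_v (f v)%:E)%E.
Proof.
move=> /integrable_tame/integrable_fin_num => /(_ measurableT) fn.
by rewrite /Ex /Rintegral fineK.
Qed.

Lemma Ex_cst n (c : R) : Ex n (fun=> c) = c.
Proof.
rewrite /Ex Rintegral_cst//.
have /= -> := probability_setT (gauss n); exact: mulr1.
Qed.

Lemma ExD n (f g : vec R n -> R) : tame n f -> tame n g ->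
  Ex n (fun v => f v + g v) = Ex n f + Ex n g.
Proof. by move=> tf tg; apply: RintegralD => //; exact: integrable_tame. Qed.

Lemma ExB n (f g : vec R n -> R) : tame n f -> tame n g ->
  Ex n (fun v => f v - g v) = Ex n f - Ex n g.
Proof. by move=> tf tg; apply: RintegralB => //; exact: integrable_tame. Qed.

Lemma ExZ n (c : R) (f : vec R n -> R) : tame n f ->
  Ex n (fun v => c * f v) = c * Ex n f.
Proof. by move=> tf; apply: RintegralZl => //; exact: integrable_tame. Qed.

Lemma Ex_le n (f g : vec R n -> R) : tame n f -> tame n g ->
  (forall v, f v <= g v) -> Ex n f <= Ex n g.
Proof.
by move=> tf tg fg; apply: le_Rintegral => //; exact: integrable_tame.
Qed.

Lemma Ex_ge0 n (f : vec R n -> R) : (forall v, 0 <= f v) -> 0 <= Ex n f.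
Proof. by move=> f0; exact: Rintegral_ge0. Qed.

Lemma Ex_sum n (I : Type) (r : seq I) (P : pred I) (f : I -> vec R n -> R) :
  (forall i, P i -> tame n (f i)) ->
  Ex n (fun v => \sum_(i <- r | P i) f i v) = \sum_(i <- r | P i) Ex n (f i).
Proof.
move=> tf; elim: r => [|i r IH].
  by rewrite big_nil -[RHS](Ex_cst n 0); congr Ex; apply/funext => v; rewrite big_nil.
rewrite big_cons; case: (boolP (P i)) => Pi; last first.
  by rewrite -IH; congr Ex; apply/funext => v; rewrite big_cons (negbTE Pi).
rewrite -IH -ExD; [|exact: tf|exact: tame_sum].
by congr Ex; apply/funext => v; rewrite big_cons Pi.
Qed.

Lemma tame_vshift n u (f : vec R n -> R) : tame n f ->
  tame n (fun v => f (vshift n u v)).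
Proof.
move=> [mf [a [b fab]]]; split.
  exact: (measurableT_comp mf (measurable_vshift n u)).
exists (`|a| * expR (`|b| * \sum_(k < n) `|u k|)), `|b| => v.
apply: le_trans (fab _) _.
have l0 := l1_ge0 n (vshift n u v).
apply: le_trans (ler_pM_expR _ _ _ _ l0 (lexx _)) _.
rewrite -mulrA -expRD ler_wpM2l// ler_expR -mulrDr ler_wpM2l//.
rewrite !l1E -big_split /=; apply: ler_sum => k _.
by rewrite crd_vshift// addrC; exact: ler_normD.
Qed.

Lemma tame_expR_linear n (c d : nat -> R) :
  tame n (fun v => expR (\sum_(k < n) (c k * crd n v k - d k))).
Proof.
split.
  apply: measurableT_comp => //; apply: measurable_sum => k.
  by apply: measurable_funB => //; apply: measurable_funM => //; exact: measurable_crd.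
exists (expR (- \sum_(k < n) d k)), (\sum_(k < n) `|c k|) => v.
rewrite ger0_norm ?expR_ge0// -expRD ler_expR big_split /= addrC sumrN lerD2l.
rewrite l1E mulr_sumr; apply: ler_sum => k _.
apply: (le_trans (ler_norm _)); rewrite normrM ler_wpM2r//.
by rewrite (bigD1 k)//= lerDl sumr_ge0.
Qed.

Lemma Ex_shift n u (f : vec R n -> R) : tame n f -> (forall v, 0 <= f v) ->
  Ex n (fun v => f (vshift n u v)) =
  Ex n (fun v => f v * expR (\sum_(k < n) (u k * crd n v k - u k ^+ 2 / 2))).
Proof.
move=> tf f0; rewrite /Ex /Rintegral.
have mf : measurable_fun setT (EFin \o f) by apply/measurable_EFinP; case: tf.
by rewrite (integral_gauss_shift n u (EFin \o f) mf).
Qed.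

Lemma Ex_sign n u (f : vec R n -> R) :
  (forall k, (k < n)%N -> u k = 1 \/ u k = -1) ->
  tame n f -> (forall v, 0 <= f v) ->
  Ex n (fun v => f (vscale n u v)) = Ex n f.
Proof.
move=> us tf f0; rewrite /Ex /Rintegral.
have mf : measurable_fun setT (EFin \o f) by apply/measurable_EFinP; case: tf.
by rewrite (integral_gauss_sign n u (EFin \o f) us mf).
Qed.

End tame.

(** * Gaussian concentration *)

Section concentration.
Context {R : realType}.

Lemma tame1_section n (f : vec R n.+1 -> R) v : tame n.+1 f ->
  tame1 (fun x : R => f (x, v)).
Proof.
move=> [mf [a [b fab]]]; split.
  exact: (measurableT_comp mf (pair2_measurable v)).
exists (a * expR (b * l1 n v)), b => x; apply: le_trans (fab _) _.
by rewrite /= mulrDr expRD mulrA mulrAC.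
Qed.

Lemma E1_EFin (f : R -> R) : tame1 f ->
  ((E1 f)%:E = \int[stdnormal R]_x (f x)%:E)%E.
Proof.
move=> /integrable_tame1/integrable_fin_num => /(_ measurableT) fn.
by rewrite /E1 /Rintegral fineK.
Qed.

Lemma E1_cst (c : R) : E1 (fun=> c) = c.
Proof.
rewrite /E1 Rintegral_cst//.
have /= -> := probability_setT (stdnormal R); exact: mulr1.
Qed.

Lemma E1D (f g : R -> R) : tame1 f -> tame1 g ->
  E1 (fun x => f x + g x) = E1 f + E1 g.
Proof. by move=> tf tg; apply: RintegralD => //; exact: integrable_tame1. Qed.

Lemma E1Z (c : R) (f : R -> R) : tame1 f -> E1 (fun x => c * f x) = c * E1 f.
Proof. by move=> tf; apply: RintegralZl => //; exact: integrable_tame1. Qed.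

Lemma E1_le (f g : R -> R) : tame1 f -> tame1 g ->
  (forall x, f x <= g x) -> E1 f <= E1 g.
Proof.
by move=> tf tg fg; apply: le_Rintegral => //; exact: integrable_tame1.
Qed.

Lemma tame1_exp (a b : R) : tame1 (fun x => a * expR (b * x)).
Proof.
split.
  by apply: measurable_funM => //; apply: measurableT_comp => //; exact: measurable_funM.
exists `|a|, `|b| => x; rewrite normrM ler_wpM2l// ger0_norm ?expR_ge0//.
by rewrite ler_expR -normrM ler_norm.
Qed.

Lemma tame1_cst (c : R) : tame1 (fun=> c).
Proof. by split => //; exists `|c|, 0 => x; rewrite mul0r expR0 mulr1. Qed.

Lemma tame1D (f g : R -> R) : tame1 f -> tame1 g -> tame1 (fun x => f x + g x).
Proof.
move=> [mf [a [b fab]]] [mg [a' [b' gab]]]; split; first exact: measurable_funD.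
exists (`|a| + `|a'|), (`|b| + `|b'|) => v.
apply: le_trans (ler_normD _ _) _; rewrite mulrDl; apply: lerD.
  by apply: le_trans (fab v) _; apply: ler_pM_expR; rewrite ?lerDl.
by apply: le_trans (gab v) _; apply: ler_pM_expR; rewrite ?lerDr.
Qed.

Lemma tame1Z (c : R) (f : R -> R) : tame1 f -> tame1 (fun x => c * f x).
Proof.
move=> [mf [a [b fab]]]; split; first exact: measurable_funM.
by exists (`|c| * a), b => x; rewrite normrM -mulrA ler_wpM2l.
Qed.

Lemma E1_exp (t : R) : E1 (fun x => expR (t * x)) = expR (t ^+ 2 / 2).
Proof. by rewrite /E1 /Rintegral integral_stdnormal_expR. Qed.

Lemma tame_marginal n (f : vec R n.+1 -> R) : tame n.+1 f ->
  tame n (fun v => E1 (fun x => f (x, v))).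
Proof.
move=> tf; have := tf => -[mf [a [b fab]]].
have mG := measurable_fubini_G (integrable_tame n.+1 f tf).
split.
  apply: (measurableT_comp _ mG).
  exact: fine_measurable.
exists (`|a| * E1 (fun x => expR (b * `|x|))), b => v.
have tb : tame1 (fun x : R => (`|a| * expR (b * l1 n v)) * expR (b * `|x|)).
  split.
    apply: measurable_funM => //; apply: measurableT_comp => //.
    by apply: measurable_funM => //; exact: measurableT_comp.
  exists (`|a| * expR (b * l1 n v)), b => x.
  by rewrite ger0_norm// !mulr_ge0 ?expR_ge0.
have tb' : tame1 (fun x : R => expR (b * `|x|)).
  split.
    apply: measurableT_comp => //.
    by apply: measurable_funM => //; exact: measurableT_comp.
  by exists 1, b => x; rewrite mul1r ger0_norm// expR_ge0.
have t1 := tame1_section n f v tf.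
have bnd x : `|f (x, v)| <= (`|a| * expR (b * l1 n v)) * expR (b * `|x|).
  apply: le_trans (fab _) _; rewrite /= -mulrA -expRD addrC mulrDr.
  by rewrite ler_wpM2r ?expR_ge0// ler_norm.
rewrite mulrAC -E1Z// ler_norml; apply/andP; split.
  rewrite -mulN1r -E1Z//; apply: E1_le => //; first exact: tame1Z.
  by move=> x; have := bnd x; rewrite ler_norml mulN1r => /andP[].
by apply: E1_le => // x; apply: le_trans (bnd x); exact: ler_norm.
Qed.

Lemma ExS n (f : vec R n.+1 -> R) : tame n.+1 f ->
  Ex n.+1 f = Ex n (fun v => E1 (fun x => f (x, v))).
Proof.
move=> tf; rewrite /Ex /Rintegral.
rewrite -(integral21_prod_meas1 (integrable_tame n.+1 f tf)); congr fine.
by apply: eq_integral => v _; rewrite E1_EFin//; exact: tame1_section.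
Qed.

(** Monotonicity of the hyperbolic cosine in the absolute value: with [1 <= U <= V], the difference
    of [V + 1/V] and [U + 1/U] is [(V - U) * (1 - 1/(U V))]. *)
Lemma expRV_addN_le (u w : R) : `|u| <= `|w| ->
  expR u + expR (- u) <= expR w + expR (- w).
Proof.
have E (z : R) : expR z + expR (- z) = expR `|z| + (expR `|z|)^-1.
  by case: (ger0P z) => _; rewrite -expRN ?opprK// addrC.
move=> uw; rewrite !E.
have U1 : 1 <= expR `|u| by rewrite -expR0 ler_expR.
have UW : expR `|u| <= expR `|w| by rewrite ler_expR.
move: U1 UW; set U := expR _; set V := expR _ => U1 UV.
have U0 : 0 < U by lra.
have V0 : 0 < V by lra.
rewrite -subr_ge0 (_ : _ - _ = (V - U) * (1 - (U * V)^-1)); last first.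
  by field; rewrite !gt_eqF.
apply: mulr_ge0; first lra.
rewrite subr_ge0 invf_le1 ?mulr_gt0//; nra.
Qed.

Lemma lipschitz_tame1 (g : R -> R) (k : R) : measurable_fun setT g ->
  (forall x y, `|g x - g y| <= k * `|x - y|) -> tame1 g.
Proof.
move=> mg gk; split => //; exists (`|g 0| + 1), `|k| => x.
have := gk x 0; rewrite subr0 => gx0.
apply: (@le_trans _ _ ((`|g 0| + 1) * (1 + `|k| * `|x|))); last first.
  by rewrite ler_wpM2l ?addr_ge0// expR_ge1Dx.
have /= := ler_normD (g x - g 0) (g 0); rewrite subrK.
have : k * `|x| <= `|k| * `|x| by rewrite ler_wpM2r// ler_norm.
have : 0 <= `|k| * `|x| by rewrite mulr_ge0.
have := normr_ge0 (g 0); nra.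
Qed.

Lemma lipschitz_tame1_exp (g : R -> R) (k l : R) : measurable_fun setT g ->
  (forall x y, `|g x - g y| <= k * `|x - y|) -> tame1 (fun x => expR (l * g x)).
Proof.
move=> mg gk; split.
  by apply: measurableT_comp => //; exact: measurable_funM.
exists (expR (`|l| * `|g 0|)), (`|l| * k) => x; rewrite ger0_norm ?expR_ge0//.
rewrite -expRD ler_expR -mulrA -mulrDr.
apply: (le_trans (ler_norm _)); rewrite normrM ler_wpM2l//.
have := gk x 0; rewrite subr0.
have /= := ler_normD (g x - g 0) (g 0); rewrite subrK; lra.
Qed.

(* With x, y independent copies, E e^{l(g x - E g)} <= E E e^{l(g x - g y)} by
   Jensen, and symmetrization bounds the latter by E E cosh (l k (x - y)). *)
Lemma lipschitz_mgf1 (g : R -> R) (k l : R) : measurable_fun setT g ->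
  (forall x y, `|g x - g y| <= k * `|x - y|) ->
  E1 (fun x => expR (l * g x)) <= expR (l ^+ 2 * k ^+ 2) * expR (l * E1 g).
Proof.
move=> mg gk.
have tg := lipschitz_tame1 g k mg gk.
have te t := lipschitz_tame1_exp g k t mg gk.
have tx (t : R) : tame1 (fun x => expR (t * x)).
  have := tame1_exp 1 t; congr tame1; apply/funext => x; exact: mul1r.
set a := E1 _; set m := E1 g.
pose b := E1 (fun x => expR (- l * g x)).
have a0 : 0 <= a by apply: Rintegral_ge0 => x _; exact: expR_ge0.
(* Jensen's inequality, by integrating the tangent line of the exponential at [- l * m]. *)
have jensen : expR (- l * m) <= b.
  have -> : expR (- l * m) =
      E1 (fun x => expR (- l * m) * (1 + l * m) + (- l * expR (- l * m)) * g x).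
    rewrite E1D; [|exact: tame1_cst|exact: tame1Z].
    by rewrite E1_cst E1Z// -/m; ring.
  apply: E1_le => //; first by apply: tame1D; [exact: tame1_cst|exact: tame1Z].
  move=> x; rewrite [- l * g x](_ : _ = - l * m + - l * (g x - m)); last by ring.
  rewrite expRD.
  apply: (@le_trans _ _ (expR (- l * m) * (1 + - l * (g x - m)))).
    by rewrite le_eqVlt; apply/orP; left; apply/eqP; ring.
  by rewrite ler_wpM2l ?expR_ge0// expR_ge1Dx.
(* The comparison of hyperbolic cosines at [l * (g x - g y)] and [l * k * (x - y)], integrated in
   [y]. A further integration in [x] gives [2 a b <= 2 exp (l^2 k^2)]. *)
have key x : expR (l * g x) * b + expR (- l * g x) * a
    <= expR (l * k * x) * E1 (fun y => expR (- (l * k) * y))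
     + expR (- (l * k) * x) * E1 (fun y => expR (l * k * y)).
  rewrite -!E1Z// -!E1D//; try exact: tame1Z.
  apply: E1_le; try by apply: tame1D; exact: tame1Z.
  move=> y; rewrite -!expRD.
  have -> : l * g x + - l * g y = l * (g x - g y) by ring.
  have -> : - l * g x + l * g y = - (l * (g x - g y)) by ring.
  have -> : l * k * x + - (l * k) * y = l * k * (x - y) by ring.
  have -> : - (l * k) * x + l * k * y = - (l * k * (x - y)) by ring.
  apply: expRV_addN_le; rewrite -mulrA !normrM ler_wpM2l//.
  apply: le_trans (gk x y) _; by rewrite ler_wpM2r// ler_norm.
have ab : a * b <= expR (l ^+ 2 * k ^+ 2).
  have : E1 (fun x => expR (l * g x) * b + expR (- l * g x) * a)
    <= E1 (fun x => expR (l * k * x) * E1 (fun y => expR (- (l * k) * y))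
     + expR (- (l * k) * x) * E1 (fun y => expR (l * k * y))).
    have tC (f : R -> R) (c : R) : tame1 f -> tame1 (fun x => f x * c).
      move=> tf; have := tame1Z c f tf; congr tame1; apply/funext => x.
      exact: mulrC.
    by apply: E1_le => //; apply: tame1D; exact: tC.
  under eq_fun do rewrite mulrC [_ * a]mulrC.
  under [X in _ <= E1 X]eq_fun do
    rewrite [expR (l * k * _) * _]mulrC [expR (- (l * k) * _) * _]mulrC.
  rewrite !E1D; try exact: tame1Z.
  rewrite !E1Z// -/a -/b !E1_exp sqrrN -expRD.
  rewrite (_ : _ / 2 + _ = l ^+ 2 * k ^+ 2); last by field.
  by rewrite [a * b]mulrC; lra.
have mab : a * expR (- l * m) <= expR (l ^+ 2 * k ^+ 2).
  by apply: le_trans ab; rewrite ler_wpM2l.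
by rewrite -ler_pdivrMr ?expR_gt0// -expRN -mulNr.
Qed.

(** The constant [k] holds for each coordinate separately, so the variance proxy is [n k^2]; for the
    log-partition functions at [x = beta * theta] it is [beta^2 V / 2], linear in the volume. *)
Definition lipschitz n (k : R) (f : vec R n -> R) :=
  forall v w, `|f v - f w| <= k * \sum_(i < n) `|crd n v i - crd n w i|.

Lemma lipschitz_tame n k (f : vec R n -> R) : measurable_fun setT f ->
  lipschitz n k f -> tame n f.
Proof.
move=> mf fk; split => //; pose o := mkvec n (fun=> 0 : R).
have fo v : `|f v - f o| <= k * l1 n v.
  rewrite l1E; have := fk v o; congr (_ <= _ * _); apply: eq_bigr => i _.
  by rewrite crd_mkvec// subr0.
exists (`|f o| + 1), `|k| => v; have l0 := l1_ge0 n v.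
apply: (@le_trans _ _ ((`|f o| + 1) * (1 + `|k| * l1 n v))); last first.
  by rewrite ler_wpM2l ?addr_ge0// expR_ge1Dx.
have /= := ler_normD (f v - f o) (f o); rewrite subrK.
have : k * l1 n v <= `|k| * l1 n v by rewrite ler_wpM2r// ler_norm.
have : 0 <= `|k| * l1 n v by rewrite mulr_ge0.
have := normr_ge0 (f o); have := fo v; nra.
Qed.

Lemma lipschitz_tame_exp n k l (f : vec R n -> R) : measurable_fun setT f ->
  lipschitz n k f -> tame n (fun v => expR (l * f v)).
Proof.
move=> mf fk; split.
  by apply: measurableT_comp => //; exact: measurable_funM.
pose o := mkvec n (fun=> 0 : R).
have fo v : `|f v - f o| <= k * l1 n v.
  rewrite l1E; have := fk v o; congr (_ <= _ * _); apply: eq_bigr => i _.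
  by rewrite crd_mkvec// subr0.
exists (expR (`|l| * `|f o|)), (`|l| * k) => v; rewrite ger0_norm ?expR_ge0//.
rewrite -expRD ler_expR -mulrA -mulrDr.
apply: (le_trans (ler_norm _)); rewrite normrM ler_wpM2l//.
have /= := ler_normD (f v - f o) (f o); rewrite subrK; have := fo v; lra.
Qed.

(** The first coordinate is integrated out with [lipschitz_mgf1]; the marginal keeps the constant
    [k] in the remaining coordinates, so one factor accrues per coordinate. The exponent is twice
    the sharp one, which only changes constants. *)
Lemma lipschitz_mgf n k l (f : vec R n -> R) : measurable_fun setT f ->
  lipschitz n k f ->
  Ex n (fun v => expR (l * f v))
    <= expR (n%:R * (l ^+ 2 * k ^+ 2)) * expR (l * Ex n f).
Proof.
elim: n f => [|n IH] f mf fk.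
  rewrite (_ : f = fun=> f tt); last by apply/funext => -[].
  by rewrite !Ex_cst mul0r expR0 mul1r.
have tf := lipschitz_tame n.+1 k f mf fk.
have te := lipschitz_tame_exp n.+1 k l f mf fk.
have ms v : measurable_fun setT (fun x : R => f (x, v)).
  by case: (tame1_section n f v tf).
have ls v x y : `|f (x, v) - f (y, v)| <= k * `|x - y|.
  have := fk (x, v) (y, v); rewrite big_ord_recl /= big1 ?addr0//.
  by move=> i _; rewrite subrr normr0.
pose fb (v : vec R n) := E1 (fun x => f (x, v)).
have tfb : tame n fb := tame_marginal n f tf.
have lfb : lipschitz n k fb.
  move=> v w; rewrite /fb.
  have tv u := tame1_section n f u tf.
  have fvw x : `|f (x, v) - f (x, w)| <= k * \sum_(i < n) `|crd n v i - crd n w i|.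
    have := fk (x, v) (x, w); rewrite big_ord_recl /= subrr normr0 add0r.
    by apply.
  set C := k * _ in fvw *.
  rewrite ler_norml; apply/andP; split.
    rewrite lerBrDr -[- C]E1_cst addrC -E1D//; last exact: tame1_cst.
    apply: E1_le => //; first by apply: tame1D => //; exact: tame1_cst.
    by move=> x; have := fvw x; rewrite ler_norml => /andP[]; lra.
  rewrite lerBlDr -[C]E1_cst -E1D//; last exact: tame1_cst.
  apply: E1_le => //; first by apply: tame1D => //; exact: tame1_cst.
  by move=> x; have := fvw x; rewrite ler_norml => /andP[]; lra.
rewrite !ExS// -/fb.
have [mfb _] := tfb.
apply: (@le_trans _ _ (Ex n (fun v => expR (l ^+ 2 * k ^+ 2) * expR (l * fb v)))).
  apply: Ex_le; first exact: tame_marginal te.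
    by apply: tameZ; exact: (lipschitz_tame_exp n k).
  by move=> v; exact: lipschitz_mgf1.
rewrite ExZ; last exact: (lipschitz_tame_exp n k).
rewrite (_ : n.+1%:R * _ = l ^+ 2 * k ^+ 2 + n%:R * (l ^+ 2 * k ^+ 2)); last first.
  by rewrite -natr1; ring.
rewrite expRD -mulrA; apply: ler_wpM2l; first exact: expR_ge0.
exact: IH.
Qed.

End concentration.

(** * Tail bounds and Gaussian integration by parts *)

Section tails.
Context {R : realType}.

Lemma tame_bool n (b : vec R n -> bool) : measurable_fun setT b ->
  tame n (fun v => (b v)%:R).
Proof.
move=> mb; apply: (@tame_bnd _ _ _ 1); last by move=> v; case: (b v); rewrite ?normr1 ?normr0.
rewrite (_ : (fun _ => _) = (fun v => if b v then 1 else 0 : R)); last first.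
  by apply/funext => v; case: (b v).
exact: measurable_fun_ifT.
Qed.

Lemma lipschitz_upper_tail n k (D t : R) (f : vec R n -> R) :
  measurable_fun setT f -> lipschitz n k f -> 0 < D -> n%:R * k ^+ 2 <= D ->
  0 <= t -> Ex n (fun v => (Ex n f + t <= f v)%R%:R) <= expR (- (t ^+ 2 / (4 * D))).
Proof.
(* Minimizer of the Chernoff exponent [l^2 D - l t]. *)
move=> mf fk D0 nkD t0; pose l := t / (2 * D).
have tl := lipschitz_tame_exp n k l f mf fk.
have l0 : 0 <= l by rewrite divr_ge0// mulr_ge0// ltW.
pose c := expR (- (l * (Ex n f + t))).
apply: (@le_trans _ _ (Ex n (fun v => c * expR (l * f v)))).
  apply: Ex_le; [|exact: tameZ|].
    by apply: tame_bool; exact: measurable_fun_ler.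
  move=> v; rewrite /c -expRD; case: (leP (Ex n f + t) (f v)) => h /=; last exact: expR_ge0.
  by rewrite -[leLHS]expR0 ler_expR -mulNr mulNr addrC -mulrBr mulr_ge0// subr_ge0.
rewrite ExZ// /c.
apply: (@le_trans _ _ (expR (- (l * (Ex n f + t))) *
   (expR (n%:R * (l ^+ 2 * k ^+ 2)) * expR (l * Ex n f)))).
  by rewrite ler_wpM2l ?expR_ge0//; exact: lipschitz_mgf.
rewrite -!expRD ler_expR.
have h : n%:R * (l ^+ 2 * k ^+ 2) <= l ^+ 2 * D.
  by rewrite mulrCA ler_wpM2l// sqr_ge0.
rewrite (_ : - (t ^+ 2 / (4 * D)) = l ^+ 2 * D - l * t); first lra.
by rewrite /l; field; rewrite gt_eqF.
Qed.

Lemma lipschitz_lower_tail n k (D t : R) (f : vec R n -> R) :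
  measurable_fun setT f -> lipschitz n k f -> 0 < D -> n%:R * k ^+ 2 <= D ->
  0 <= t -> Ex n (fun v => (f v <= Ex n f - t)%R%:R) <= expR (- (t ^+ 2 / (4 * D))).
Proof.
move=> mf fk D0 nkD t0; have tf := lipschitz_tame n k f mf fk.
have EN : Ex n (fun v => - f v) = - Ex n f.
  rewrite -mulN1r -ExZ//; congr Ex; apply/funext => v; by rewrite mulN1r.
have := lipschitz_upper_tail n k D t (fun v => - f v).
rewrite EN.
rewrite (_ : (fun v => _%:R) = (fun v => (f v <= Ex n f - t)%R%:R)); last first.
  by apply/funext => v; rewrite lerNr opprD opprK.
apply => //; first exact: measurable_funN.
by move=> v w; rewrite -opprD normrN.
Qed.

End tails.

Section stein.
Context {R : realType}.

Lemma expR_taylor1 (z : R) : `|expR z - 1 - z| <= z ^+ 2 * expR `|z|.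
Proof.
have h1 : 1 + z <= expR z := expR_ge1Dx z.
have h2 : expR z - 1 <= z * expR z.
  have := expR_ge1Dx (- z); rewrite expRN => h3.
  have e0 := expR_gt0 z.
  have : (1 - z) * expR z <= 1 by rewrite -ler_pdivlMr// div1r.
  lra.
rewrite ger0_norm; last lra.
apply: (@le_trans _ _ (z * (expR z - 1))); first nra.
case: (ger0P z) => z0; first by nra.
have : 1 <= expR (- z) by rewrite -expR0 ler_expR; lra.
nra.
Qed.

Definition ecrd (k : nat) (t : R) (j : nat) : R := if j == k then t else 0.

Lemma sum_ecrd n k t (c : nat -> R) : (k < n)%N ->
  \sum_(j < n) (ecrd k t j * c j - ecrd k t j ^+ 2 / 2) = t * c k - t ^+ 2 / 2.
Proof.
move=> kn; rewrite (bigD1 (Ordinal kn))//= /ecrd eqxx big1 ?addr0//.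
by move=> i; rewrite -val_eqE /= => /negbTE ->; rewrite mul0r expr0n /= mul0r subr0.
Qed.

Lemma tame_exp_norm n k (b c : R) : (k < n)%N ->
  tame n (fun v => expR (b * `|crd n v k| + c)).
Proof.
move=> kn; split.
  apply: measurableT_comp => //; apply: measurable_funD => //.
  apply: measurable_funM => //; apply: measurableT_comp => //.
  exact: measurable_crd.
exists (expR c), `|b| => v; rewrite ger0_norm ?expR_ge0// -expRD ler_expR addrC.
rewrite lerD2l; apply: (@le_trans _ _ (`|b| * `|crd n v k|)).
  by rewrite ler_wpM2r// ler_norm.
by rewrite ler_wpM2l// l1E (bigD1 (Ordinal kn))//= lerDl sumr_ge0.
Qed.

(** Both sides of the shift formula [E F(v + t e_k) = E F(v) exp (t v_k - t^2/2)] are expanded to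
    first order in [t]: the coefficients are [E F'] on the left and [E v_k F] on the right.
    Nonnegativity of [F] comes from [Ex_shift], and the quadratic remainder is uniform in [v]. *)
Lemma stein_ge0 n k (F F' : vec R n -> R) (B c t0 : R) : (k < n)%N ->
  tame n F -> tame n F' -> (forall v, 0 <= F v <= B) -> 0 < t0 ->
  (forall t v, 0 < t < t0 ->
     `|F (vshift n (ecrd k t) v) - F v - t * F' v| <= c * t ^+ 2) ->
  Ex n (fun v => crd n v k * F v) = Ex n F'.
Proof.
move=> kn tF tF' FB t00 FF'.
have tx := tame_crd n k kn.
have txF : tame n (fun v => crd n v k * F v) by exact: tameM.
set X := Ex n _; set Y := Ex n F'.
have F0 v : 0 <= F v by case/andP: (FB v).
(* With [q = |v_k|] and [t < 1], the exponent satisfies [|z| <= t (q + 1)], so the Taylor remainder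
   [z^2 exp |z|] is at most [t^2 exp (2 q) exp (q + 1)]; hence the exponent [3 q + 1]. *)
pose K := Ex n (fun v : vec R n => expR (3 * `|crd n v k| + 1)).
have tK : tame n (fun v : vec R n => expR (3 * `|crd n v k| + 1)) by exact: tame_exp_norm.
have B0 : 0 <= B by case/andP: (FB (mkvec n (fun=> 0))); exact: le_trans.
have main t : 0 < t -> t < t0 -> t < 1 -> `|X - Y| <= (`|c| + B * (K + 1)) * t.
  move=> tp tt0 t1.
  have tS : tame n (fun v => F (vshift n (ecrd k t) v)) by exact: tame_vshift.
  pose z (v : vec R n) := t * crd n v k - t ^+ 2 / 2.
  have tez : tame n (fun v => expR (z v)).
    have := tame_expR_linear n (ecrd k t) (fun j => ecrd k t j ^+ 2 / 2).
    by congr tame; apply/funext => v; rewrite sum_ecrd.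
  have tz : tame n z by apply: tameB; [exact: tameZ|exact: tame_cst].
  have shift := Ex_shift n (ecrd k t) F tF F0.
  have tA : tame n (fun v => F (vshift n (ecrd k t) v) - F v - t * F' v).
    by apply: tameB; [exact: tameB|exact: tameZ].
  have e1 : `|Ex n (fun v => F (vshift n (ecrd k t) v)) - Ex n F - t * Y| <= `|c| * t ^+ 2.
    rewrite /Y -ExZ// -!ExB//; last 2 first.
    - exact: tameB.
    - exact: tameZ.
    have c2 v : `|F (vshift n (ecrd k t) v) - F v - t * F' v| <= `|c| * t ^+ 2.
      apply: le_trans (FF' t v _) _; first by rewrite tp.
      by rewrite ler_wpM2r ?sqr_ge0// ler_norm.
    rewrite ler_norml; apply/andP; split.
      rewrite -[leLHS](Ex_cst n); apply: Ex_le => //; first exact: tame_cst.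
      by move=> v; have := c2 v; rewrite ler_norml => /andP[].
    rewrite -[leRHS](Ex_cst n); apply: Ex_le => //; first exact: tame_cst.
    by move=> v; have := c2 v; rewrite ler_norml => /andP[].
  have e2 : `|Ex n (fun v => F v * expR (z v)) - Ex n F - t * X|
      <= B * (K + 1) * t ^+ 2.
    rewrite /X -ExZ// -!ExB//; last 3 first.
    - by apply: tameB => //; exact: tameM.
    - exact: tameZ.
    - exact: tameM.
    have tR : tame n (fun v : vec R n => (B * t ^+ 2) * (expR (3 * `|crd n v k| + 1) + 1)).
      by apply: tameZ; apply: tameD => //; exact: tame_cst.
    have tD : tame n (fun v => F v * expR (z v) - F v - t * (crd n v k * F v)).
      by apply: tameB; [apply: tameB => //; exact: tameM|exact: tameZ].
    have -> : B * (K + 1) * t ^+ 2 =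
        Ex n (fun v : vec R n => (B * t ^+ 2) * (expR (3 * `|crd n v k| + 1) + 1)).
      rewrite ExZ; last by apply: tameD => //; exact: tame_cst.
      rewrite ExD//; last exact: tame_cst.
      by rewrite Ex_cst -/K; ring.
    have pt v : `|F v * expR (z v) - F v - t * (crd n v k * F v)|
        <= (B * t ^+ 2) * (expR (3 * `|crd n v k| + 1) + 1).
      have -> : F v * expR (z v) - F v - t * (crd n v k * F v)
        = F v * (expR (z v) - 1 - z v - t ^+ 2 / 2) by rewrite /z; ring.
      rewrite normrM ger0_norm// -mulrA.
      have /andP[_ FvB] := FB v.
      apply: ler_pM => //.
      apply: le_trans (ler_normB _ _) _; rewrite mulrDr mulr1; apply: lerD; last first.
        by rewrite ger0_norm; have := sqr_ge0 t; nra.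
      apply: le_trans (expR_taylor1 _) _.
      have az : `|z v| <= t * (`|crd n v k| + 1).
        rewrite /z; apply: le_trans (ler_normB _ _) _; rewrite normrM.
        have := normr_ge0 (crd n v k).
        rewrite (gtr0_norm tp) (ger0_norm (_ : 0 <= t ^+ 2 / 2)); first nra.
        by rewrite divr_ge0// sqr_ge0.
      set q := `|crd n v k| in az *.
      have q0 : 0 <= q by exact: normr_ge0.
      have z2 : z v ^+ 2 <= t ^+ 2 * (q + 1) ^+ 2.
        rewrite -exprMn -[z v ^+ 2]real_normK ?num_real//.
        by rewrite lerXn2r ?nnegrE// mulr_ge0 ?ltW//; lra.
      have eq1 : (q + 1) ^+ 2 <= expR (2 * q).
        rewrite mulr_natl mulr2n expRD -expr2 lerXn2r ?nnegrE ?expR_ge0//; first lra.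
        by rewrite addrC expR_ge1Dx.
      have -> : 3 * q + 1 = 2 * q + (q + 1) by ring.
      rewrite expRD mulrA; apply: ler_pM; rewrite ?sqr_ge0 ?expR_ge0//.
        apply: le_trans z2 _; by rewrite ler_wpM2l// sqr_ge0.
      rewrite ler_expR; apply: le_trans az _; nra.
    rewrite ler_norml; apply/andP; split.
      rewrite lerNl -mulN1r -ExZ//; apply: Ex_le => //; first exact: tameZ.
      by move=> v; have := pt v; rewrite ler_norml mulN1r lerNl => /andP[].
    by apply: Ex_le => // v; have := pt v; rewrite ler_norml => /andP[].
  have shift' : Ex n (fun v => F (vshift n (ecrd k t) v)) =
      Ex n (fun v => F v * expR (z v)).
    rewrite shift; congr Ex; apply/funext => v; by rewrite sum_ecrd.
  rewrite shift' in e1.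
  have : `|t * X - t * Y| <= (`|c| + B * (K + 1)) * t ^+ 2.
    move: e1 e2; rewrite !ler_norml => /andP[? ?] /andP[? ?].
    by rewrite mulrDl; apply/andP; split; lra.
  by rewrite -mulrBr normrM gtr0_norm// expr2 mulrA mulrC ler_pM2r.
apply/eqP; rewrite -subr_eq0 -normr_le0; apply/ler_addgt0Pl => e e0.
rewrite addr0.
set C := `|c| + _ in main.
have C0 : 0 <= C.
  by rewrite addr_ge0// mulr_ge0// addr_ge0//; apply: Ex_ge0 => v; exact: expR_ge0.
pose t := Num.min (Num.min (t0 / 2) (1 / 2)) (e / (C + 1)).
have C1 : 0 < C + 1 by lra.
have tp : 0 < t by rewrite !lt_min divr_gt0//= divr_gt0//= divr_gt0.
have tt0 : t <= t0 / 2 by rewrite !ge_min lexx.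
have t1 : t <= 1 / 2 by rewrite !ge_min lexx orbT.
have te : t <= e / (C + 1) by rewrite ge_min lexx orbT.
apply: le_trans (main t tp _ _) _; [lra|lra|].
move: te; rewrite ler_pdivlMr//; nra.
Qed.

End stein.

(** * Gibbs averages of a Gaussian spin system *)

Section spins.
Context {R : realType} (n : nat) {C : finType} (s : C -> nat -> R).
Hypothesis s_pm : forall c k, (k < n)%N -> s c k = 1 \/ s c k = -1.

Definition energy (c : C) (v : vec R n) : R := \sum_(k < n) s c k * crd n v k.

(** Leaving the weights [a] free makes the normalized partition function, the planted one and each
    of its layers instances of one object. *)
Definition wsum (a : C -> R) (x : R) (v : vec R n) : R :=
  \sum_c a c * expR (x * energy c v).

Definition gibbs (a : C -> R) (x : R) (f : C -> R) (v : vec R n) : R :=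
  (\sum_c a c * expR (x * energy c v) * f c) / wsum a x v.

Definition weights (a : C -> R) := (forall c, 0 <= a c) /\ exists c, 0 < a c.

Lemma s_sqr c k : (k < n)%N -> s c k * s c k = 1.
Proof. by move=> kn; case: (s_pm c k kn) => ->; rewrite ?mulr1// mulrNN mulr1. Qed.

Lemma s_norm c k : (k < n)%N -> `|s c k| = 1.
Proof. by move=> kn; case: (s_pm c k kn) => ->; rewrite ?normrN normr1. Qed.

Lemma tame_exp_hm c x : tame n (fun v => expR (x * energy c v)).
Proof.
have := tame_expR_linear n (fun k => x * s c k) (fun=> 0).
congr tame; apply/funext => v; congr expR; rewrite /energy mulr_sumr.
by apply: eq_bigr => k _; rewrite subr0 mulrA.
Qed.

Lemma tame_Sw a x : tame n (wsum a x).
Proof. by apply: tame_sum => c _; apply: tameZ; exact: tame_exp_hm. Qed.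

Lemma Sw_gt0 a x v : weights a -> 0 < wsum a x v.
Proof.
move=> [a0 [c ac]]; rewrite /wsum (bigD1 c)//= ltr_pwDl ?mulr_gt0 ?expR_gt0//.
by apply: sumr_ge0 => c' _; rewrite mulr_ge0 ?expR_ge0.
Qed.

Lemma hm_lipschitz c v w :
  `|energy c v - energy c w| <= \sum_(k < n) `|crd n v k - crd n w k|.
Proof.
rewrite /energy -sumrB; apply: le_trans (ler_norm_sum _ _ _) _.
by apply: ler_sum => k _; rewrite -mulrBr normrM s_norm// mul1r.
Qed.

Lemma measurable_lnSw a x : weights a -> measurable_fun setT (fun v => ln (wsum a x v)).
Proof.
by move=> wa; apply: measurableT_comp => //; case: (tame_Sw a x).
Qed.

Lemma lnSw_lipschitz a x : weights a -> 0 <= x ->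
  lipschitz n x (fun v => ln (wsum a x v)).
Proof.
move=> wa x0.
suff h v w : ln (wsum a x v) - ln (wsum a x w)
    <= x * \sum_(k < n) `|crd n v k - crd n w k|.
  move=> v w; rewrite ler_norml h andbT lerNl opprB.
  by apply: le_trans (h w v) _; under eq_bigr do rewrite distrC.
set d := \sum_(k < n) _.
have Sv := Sw_gt0 a x v wa; have Sw' := Sw_gt0 a x w wa.
rewrite lerBlDr -[x * d]expRK -lnM ?posrE ?expR_gt0//.
rewrite ler_ln ?posrE ?mulr_gt0 ?expR_gt0// /wsum mulr_sumr; apply: ler_sum => c _.
rewrite mulrCA ler_wpM2l//; first by case: wa.
rewrite -expRD ler_expR -mulrDr ler_wpM2l//.
have := hm_lipschitz c v w; rewrite ler_norml -/d => /andP[_]; lra.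
Qed.

Lemma tame_lnSw a x : weights a -> 0 <= x -> tame n (fun v => ln (wsum a x v)).
Proof.
move=> wa x0; apply: (lipschitz_tame n x); first exact: measurable_lnSw.
exact: lnSw_lipschitz.
Qed.

Lemma measurable_gav a x f : weights a -> measurable_fun setT (gibbs a x f).
Proof.
move=> wa; rewrite (_ : gibbs a x f = (fun v =>
    (\sum_c a c * expR (x * energy c v) * f c) * expR (- ln (wsum a x v)))); last first.
  apply/funext => v; rewrite /gibbs expRN lnK// posrE; exact: Sw_gt0.
apply: measurable_funM.
  apply: measurable_sum => c; apply: measurable_funM => //.
  by apply: measurable_funM => //; case: (tame_exp_hm c x).
apply: measurableT_comp => //; apply: measurable_funN; exact: measurable_lnSw.
Qed.

(** Comparing only where [a c > 0] allows the use of an overlap bound that is valid inside a layer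
    alone. *)
Lemma gav_le a x f g v : weights a -> (forall c, 0 < a c -> f c <= g c) ->
  gibbs a x f v <= gibbs a x g v.
Proof.
move=> wa fg; have S0 := ltW (Sw_gt0 a x v wa).
rewrite /gibbs ler_wpM2r ?invr_ge0//; apply: ler_sum => c _; have := wa.1 c; rewrite le_eqVlt => /predU1P[<-|ac].
  by rewrite !mul0r.
by rewrite ler_wpM2l ?fg// mulr_ge0 ?expR_ge0// ltW.
Qed.

Lemma gav_cst a x z v : weights a -> gibbs a x (fun=> z) v = z.
Proof.
by move=> wa; rewrite /gibbs -mulr_suml mulrAC divff ?mul1r// gt_eqF// Sw_gt0.
Qed.

Lemma gavD a x f g v : gibbs a x (fun c => f c + g c) v = gibbs a x f v + gibbs a x g v.
Proof.
rewrite /gibbs -mulrDl -big_split; congr (_ / _); apply: eq_bigr => c _.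
by rewrite mulrDr.
Qed.

Lemma gavZ a x z f v : gibbs a x (fun c => z * f c) v = z * gibbs a x f v.
Proof.
rewrite /gibbs mulrA mulr_sumr; congr (_ / _); apply: eq_bigr => c _; ring.
Qed.

Lemma gav_sum a x (I : Type) (r : seq I) (f : I -> C -> R) v :
  gibbs a x (fun c => \sum_(i <- r) f i c) v = \sum_(i <- r) gibbs a x (f i) v.
Proof.
rewrite /gibbs -mulr_suml exchange_big /=; congr (_ / _); apply: eq_bigr => c _.
by rewrite mulr_sumr.
Qed.

Lemma gav_norm_le a x f v (z : R) : weights a -> (forall c, `|f c| <= z) ->
  `|gibbs a x f v| <= z.
Proof.
move=> wa fz; rewrite ler_norml; apply/andP; split.
  rewrite -[leLHS](gav_cst a x _ v wa); apply: gav_le => // c _.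
  by have := fz c; rewrite ler_norml => /andP[].
rewrite -[leRHS](gav_cst a x _ v wa); apply: gav_le => // c _.
by have := fz c; rewrite ler_norml => /andP[].
Qed.

Lemma tame_gav a x f : weights a -> tame n (gibbs a x f).
Proof.
move=> wa; apply: (@tame_bnd _ _ _ (\sum_c `|f c|)); first exact: measurable_gav.
move=> v; apply: gav_norm_le => // c.
by rewrite (bigD1 c)//= lerDl sumr_ge0.
Qed.

Lemma hm_vshift c u v :
  energy c (vshift n u v) = energy c v + \sum_(k < n) s c k * u k.
Proof.
rewrite /energy -big_split /=; apply: eq_bigr => k _.
by rewrite crd_vshift// mulrDr.
Qed.

Lemma hm_shift_ecrd c k t v : (k < n)%N ->
  energy c (vshift n (ecrd k t) v) = energy c v + s c k * t.
Proof.
move=> kn; rewrite hm_vshift (bigD1 (Ordinal kn))//= /ecrd eqxx big1 ?addr0//.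
by move=> i; rewrite -val_eqE /= => /negbTE ->; rewrite mulr0.
Qed.

(* [(m cosh y + sinh y) / (cosh y + m sinh y)] with [y := x t]. *)
Lemma gav_shift_ecrd a x k t v : weights a -> (k < n)%N ->
  let m := gibbs a x (s^~ k) v in
  gibbs a x (s^~ k) (vshift n (ecrd k t) v) =
  ((expR (x * t) + expR (- (x * t))) / 2 * m + (expR (x * t) - expR (- (x * t))) / 2)
  / ((expR (x * t) + expR (- (x * t))) / 2 + (expR (x * t) - expR (- (x * t))) / 2 * m).
Proof.
move=> wa kn /=; set ch := _ / 2; set sh := _ / 2.
have S0 : wsum a x v != 0 by rewrite gt_eqF// Sw_gt0.
have es c : expR (x * (energy c v + s c k * t)) = expR (x * energy c v) * (ch + sh * s c k).
  rewrite mulrDr expRD; congr (_ * _).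
  rewrite /ch /sh; case: (s_pm c k kn) => ->; first by rewrite mul1r; field.
  by rewrite mulN1r mulrN; field.
have gN : wsum a x v * gibbs a x (s^~ k) v = \sum_c a c * expR (x * energy c v) * s c k.
  by rewrite /gibbs mulrC divfK.
have eS : wsum a x (vshift n (ecrd k t) v)
    = wsum a x v * (ch + sh * gibbs a x (s^~ k) v).
  rewrite mulrDr (mulrCA _ sh) gN {1 2}/wsum mulr_suml mulr_sumr.
  rewrite -big_split /=; apply: eq_bigr => c _.
  by rewrite hm_shift_ecrd// es; ring.
have eN : \sum_c a c * expR (x * energy c (vshift n (ecrd k t) v)) * s c k
    = wsum a x v * (ch * gibbs a x (s^~ k) v + sh).
  rewrite mulrDr (mulrCA _ ch) gN /wsum mulr_suml mulr_sumr.
  rewrite -big_split /=; apply: eq_bigr => c _.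
  rewrite hm_shift_ecrd// es.
  have ss := s_sqr c k kn.
  transitivity (a c * expR (x * energy c v) * (ch * s c k + sh * (s c k * s c k))).
    by ring.
  by rewrite ss; ring.
by rewrite {1}/gibbs eN eS -mulf_div divff// mul1r.
Qed.

(** The quantity equals [(1 - m^2) * (sinh y / D - y)], where the denominator [D] lies between
    [exp (- y)] and [exp y]. Hence [sinh y / D] lies between [(1 - exp (- 2y)) / 2] and
    [(exp (2y) - 1) / 2], both of which are [y + O(y^2)]. *)
Lemma tanh_taylor (m y : R) : -1 <= m <= 1 -> 0 < y -> y < 1 / 4 ->
  `|((expR y + expR (- y)) / 2 * m + (expR y - expR (- y)) / 2)
  / ((expR y + expR (- y)) / 2 + (expR y - expR (- y)) / 2 * m) - m
   - y * (1 - m ^+ 2)| <= 4 * y ^+ 2.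
Proof.
move=> /andP[m1 m2] y0 y1.
have := expRxMexpNx_1 y; have := expR_gt0 (- y).
have := expR_ge1Dx y; have := expR_ge1Dx (- y).
set E := expR y; set F := expR (- y) => hF hE F0 EF.
have FE : F <= E by rewrite ler_expR; lra.
pose D := (E + F) / 2 + (E - F) / 2 * m.
rewrite -/D.
have DF : F <= D by rewrite /D; nra.
have DE : D <= E by rewrite /D; nra.
have D0 : 0 < D by lra.
have -> : ((E + F) / 2 * m + (E - F) / 2) / D - m - y * (1 - m ^+ 2)
    = (1 - m ^+ 2) * ((E - F) / 2 / D - y).
  rewrite /D; field; rewrite -/D.
  by have := D0; rewrite /D => ?; rewrite gt_eqF//; lra.
rewrite normrM ger0_norm; last nra.
have E2 : E * E * (1 - 2 * y) <= 1.
  have := expR_ge1Dx (- (2 * y)); rewrite (_ : - (2 * y) = - y + - y); last ring.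
  rewrite expRD -/F => h.
  have : 0 < E * E by nra.
  nra.
have F2 : F * F * (1 + 2 * y) <= 1.
  have := expR_ge1Dx (2 * y); rewrite (_ : 2 * y = y + y); last ring.
  rewrite expRD -/E => h.
  have : 0 < F * F by nra.
  nra.
have h : `|(E - F) / 2 / D - y| <= 4 * y ^+ 2.
  have DI : D * D^-1 = 1 by rewrite divff// gt_eqF.
  have I0 : 0 < D^-1 by rewrite invr_gt0.
  set I := D^-1 in DI I0 *.
  have FI : F <= I by nra.
  have IE : I <= E by nra.
  have lo : (E - F) / 2 * F <= (E - F) / 2 * I by rewrite ler_wpM2l//; lra.
  have up : (E - F) / 2 * I <= (E - F) / 2 * E by rewrite ler_wpM2l//; lra.
  have F3 : F * F <= 1 - 2 * y + 8 * y ^+ 2.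
    have h1 : 1 <= (1 - 2 * y + 8 * y ^+ 2) * (1 + 2 * y) by nra.
    have p : 0 < 1 + 2 * y by lra.
    by rewrite -(ler_pM2r p); lra.
  have E3 : E * E <= 1 + 2 * y + 8 * y ^+ 2.
    have h1 : 1 <= (1 + 2 * y + 8 * y ^+ 2) * (1 - 2 * y) by nra.
    have p : 0 < 1 - 2 * y by lra.
    by rewrite -(ler_pM2r p); lra.
  rewrite ler_norml; apply/andP; split; nra.
apply: (@le_trans _ _ (1 * `|(E - F) / 2 / D - y|)); last by rewrite mul1r.
by rewrite ler_wpM2r//; nra.
Qed.

(** Because the spins square to 1, the derivative of the Gibbs mean [m] of [s_k] in the coupling [k]
    is [x (1 - m^2)]; [tanh_taylor] supplies the uniform remainder that [stein_ge0] asks for. *)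
Lemma gav_stein a x k : weights a -> 0 < x -> (k < n)%N ->
  Ex n (fun v => crd n v k * gibbs a x (s^~ k) v) =
  x * (1 - Ex n (fun v => gibbs a x (s^~ k) v ^+ 2)).
Proof.
move=> wa x0 kn.
pose m := gibbs a x (s^~ k).
have tm : tame n m by exact: tame_gav.
have m1 v : -1 <= m v <= 1.
  by rewrite -ler_norml; apply: gav_norm_le => // c; rewrite s_norm.
have tm2 : tame n (fun v => x * (1 - m v ^+ 2)).
  apply: tameZ; apply: tameB; [exact: tame_cst|]; exact: tameM.
have tc : tame n (fun v : vec R n => crd n v k) := tame_crd n k kn.
(* [stein_ge0] wants a nonnegative function, so it is applied to [1 + m]; the added constant
   contributes nothing because a coordinate is centered. *)
have E0 : Ex n (fun v : vec R n => crd n v k) = 0.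
  transitivity (Ex n (fun v : vec R n => crd n v k * 1)).
    by congr Ex; apply/funext => v; rewrite mulr1.
  rewrite (@stein_ge0 R n k (fun=> 1) (fun=> 0) 1 0 1 kn (tame_cst _ _) (tame_cst _ _))//.
  - exact: Ex_cst.
  - by move=> v; rewrite ler01 lexx.
  - by move=> t v _; rewrite mulr0 subrr subr0 normr0 mul0r.
transitivity (Ex n (fun v => crd n v k * (1 + m v))).
  rewrite -[LHS]add0r -E0 -ExD//; last exact: tameM.
  by congr Ex; apply/funext => v; rewrite mulrDr mulr1.
rewrite (stein_ge0 n k (fun v => 1 + m v) (fun v => x * (1 - m v ^+ 2)) 2
  (4 * x ^+ 2) (1 / 4 / x) kn (tameD _ _ _ (tame_cst _ _) tm) tm2).
- rewrite ExZ; last by apply: tameB; [exact: tame_cst|exact: tameM].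
  by rewrite ExB ?Ex_cst//; [exact: tame_cst|exact: tameM].
- by move=> v; have := m1 v; lra.
- by rewrite !divr_gt0.
- move=> t v /andP[t0 t1]; rewrite /m gav_shift_ecrd// -/m.
  have xt : 0 < x * t by rewrite mulr_gt0.
  have xt1 : x * t < 1 / 4 by rewrite mulrC -ltr_pdivlMr.
  have := tanh_taylor (m v) (x * t) (m1 v) xt xt1.
  by congr (`|_| <= _); ring.
Qed.

(** For the p-spin couplings this is the p-th power of the overlap, see [ov_overlap]. *)
Definition corr (c c' : C) : R := n%:R^-1 * \sum_(k < n) s c k * s c' k.

Definition gibbs2 (a : C -> R) (x : R) (f : C -> C -> R) (v : vec R n) : R :=
  gibbs a x (fun c => gibbs a x (f c) v) v.

Lemma gav_sqr a x f v : gibbs a x f v ^+ 2 = gibbs2 a x (fun c c' => f c * f c') v.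
Proof.
rewrite /gibbs2; under [in RHS]eq_fun do rewrite gavZ mulrC.
by rewrite gavZ.
Qed.

Lemma tame_gav2 a x f : weights a -> tame n (gibbs2 a x f).
Proof.
move=> wa; rewrite /gibbs2.
rewrite (_ : (fun v => _) = (fun v => (\sum_c a c * expR (x * energy c v) * gibbs a x (f c) v)
  * gibbs a x (fun=> 1) v / wsum a x v)); last first.
  by apply/funext => v; rewrite gav_cst// mulr1.
apply: (@tame_bnd _ _ _ (\sum_c \sum_c' `|f c c'|)).
  rewrite (_ : (fun v => _) = (fun v => (\sum_c a c * expR (x * energy c v) *
      gibbs a x (f c) v) * expR (- ln (wsum a x v)))); last first.
    apply/funext => v; rewrite gav_cst// mulr1 expRN lnK// posrE; exact: Sw_gt0.
  apply: measurable_funM.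
    apply: measurable_sum => c; apply: measurable_funM; last exact: measurable_gav.
    by apply: measurable_funM => //; case: (tame_exp_hm c x).
  apply: measurableT_comp => //; apply: measurable_funN; exact: measurable_lnSw.
move=> v; rewrite gav_cst// mulr1; apply: (gav_norm_le a x) => // c.
apply: (@le_trans _ _ (\sum_c' `|f c c'|)); last first.
  by rewrite [leRHS](bigD1 c)//= lerDl; do 2 (apply: sumr_ge0 => ? _).
by apply: gav_norm_le => // c'; rewrite (bigD1 c')//= lerDl sumr_ge0.
Qed.

(** Sum of [gav_stein] over the couplings, the squared Gibbs means being read as two-replica
    averages. This is the derivative in [x] of the expected log-partition function. *)
Lemma gav_hm_mean a x : weights a -> 0 < x -> (0 < n)%N ->
  Ex n (fun v => gibbs a x (fun c => energy c v) v) =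
  x * n%:R * (1 - Ex n (gibbs2 a x corr)).
Proof.
move=> wa x0 n0.
have tg k : tame n (gibbs a x (s^~ k)) by exact: tame_gav.
have tc k : (k < n)%N -> tame n (fun v : vec R n => crd n v k) by exact: tame_crd.
have -> : Ex n (fun v => gibbs a x (fun c => energy c v) v) =
    \sum_(k < n) Ex n (fun v => crd n v k * gibbs a x (s^~ k) v).
  rewrite -Ex_sum; last by move=> k _; apply: tameM => //; exact: tc.
  congr Ex; apply/funext => v; rewrite /energy gav_sum; apply: eq_bigr => k _.
  by rewrite -gavZ; congr gibbs; apply/funext => c; rewrite mulrC.
have -> : Ex n (gibbs2 a x corr) =
    n%:R^-1 * \sum_(k < n) Ex n (fun v => gibbs a x (s^~ k) v ^+ 2).
  rewrite -Ex_sum; last by move=> k _; exact: tameM.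
  rewrite -ExZ; last by apply: tame_sum => k _; exact: tameM.
  congr Ex; apply/funext => v; under eq_bigr do rewrite gav_sqr.
  rewrite /gibbs2 /corr.
  under eq_fun do rewrite gavZ gav_sum.
  by rewrite gavZ gav_sum.
under eq_bigr => k _ do rewrite gav_stein//.
rewrite -mulr_sumr sumrB sumr_const card_ord -mulrA; congr (_ * _).
by rewrite mulrBr mulr1 mulrA divff ?mul1r// pnatr_eq0 -lt0n.
Qed.

(** Although [corr] may be negative, its two-replica mean is an average of squared Gibbs means. *)
Lemma gav2_ov_ge0 a x v : weights a -> 0 <= gibbs2 a x corr v.
Proof.
move=> wa; rewrite /gibbs2 /corr; under eq_fun do rewrite gavZ gav_sum.
rewrite gavZ gav_sum mulr_ge0 ?invr_ge0//; apply: sumr_ge0 => k _.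
rewrite (_ : gibbs _ _ _ _ = gibbs a x (s^~ k) v ^+ 2) ?sqr_ge0//.
by rewrite gav_sqr.
Qed.

(** Jensen: the ratio of the two sums is the Gibbs average of [exp f], bounded below by the tangent
    at the mean of [f]. The term [d] accounts for weights that themselves depend on beta. *)
Lemma lnSw_convex a d x y v : weights a ->
  ln (wsum a x v) + gibbs a x (fun c => d c + (y - x) * energy c v) v
  <= ln (wsum (fun c => a c * expR (d c)) y v).
Proof.
move=> wa; set f := fun c => _; set m := gibbs a x f v.
have S0 := Sw_gt0 a x v wa.
rewrite -[m]expRK -lnM ?posrE ?expR_gt0//.
have wa' : weights (fun c => a c * expR (d c)).
  case: wa => a0 [c ac]; split; first by move=> c'; rewrite mulr_ge0 ?expR_ge0.
  by exists c; rewrite mulr_gt0 ?expR_gt0.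
rewrite ler_ln ?posrE ?mulr_gt0 ?expR_gt0 ?Sw_gt0//.
have -> : wsum (fun c => a c * expR (d c)) y v = \sum_c a c * expR (x * energy c v) * expR (f c).
  apply: eq_bigr => c _; rewrite -!mulrA -!expRD /f; congr (_ * expR _); ring.
apply: (@le_trans _ _ (\sum_c a c * expR (x * energy c v) * (expR m * (1 + f c - m)))).
  rewrite le_eqVlt; apply/orP; left; apply/eqP.
  transitivity (expR m * (wsum a x v * (1 - m) + \sum_c a c * expR (x * energy c v) * f c)).
    have -> : \sum_c a c * expR (x * energy c v) * f c = wsum a x v * m.
      by rewrite /m /gibbs mulrC divfK// gt_eqF.
    by ring.
  rewrite /wsum mulr_suml -big_split mulr_sumr; apply: eq_bigr => c _ /=; ring.
apply: ler_sum => c _; rewrite ler_wpM2l ?mulr_ge0 ?expR_ge0//; first by case: wa.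
have -> : expR (f c) = expR m * expR (f c - m) by rewrite -expRD; congr expR; ring.
by rewrite ler_wpM2l ?expR_ge0//; have := expR_ge1Dx (f c - m); lra.
Qed.

(** The increment of the expected log-partition function is at least its derivative at [x] times the
    step, with no derivative taken under the integral. *)
Lemma Ex_lnSw_convex a d x y : weights a -> 0 < x -> 0 <= y -> (0 < n)%N ->
  Ex n (fun v => ln (wsum a x v))
   + (y - x) * (x * n%:R * (1 - Ex n (gibbs2 a x corr))) + Ex n (gibbs a x d)
  <= Ex n (fun v => ln (wsum (fun c => a c * expR (d c)) y v)).
Proof.
move=> wa x0 y0 n0.
have wa' : weights (fun c => a c * expR (d c)).
  case: wa => a0 [c ac]; split; first by move=> c'; rewrite mulr_ge0 ?expR_ge0.
  by exists c; rewrite mulr_gt0 ?expR_gt0.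
have tl := tame_lnSw a x wa (ltW x0).
have td := tame_gav a x d wa.
have th : tame n (fun v => gibbs a x (fun c => energy c v) v).
  rewrite (_ : (fun v => _) = (fun v => \sum_(k < n) crd n v k * gibbs a x (s^~ k) v)).
    apply: tame_sum => k _; apply: tameM; first exact: tame_crd.
    exact: tame_gav.
  apply/funext => v; rewrite /energy gav_sum; apply: eq_bigr => k _.
  by rewrite -gavZ; congr gibbs; apply/funext => c; rewrite mulrC.
rewrite -gav_hm_mean// -ExZ// -ExD//; last exact: tameZ.
rewrite -ExD//; last by apply: tameD => //; exact: tameZ.
apply: Ex_le.
- by apply: tameD => //; apply: tameD => //; exact: tameZ.
- exact: tame_lnSw.
move=> v; apply: le_trans (lnSw_convex a d x y v wa).
by rewrite gavD gavZ; lra.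
Qed.

End spins.

(** * Planting and gauge symmetry *)

Lemma drop_lower_bound (R : realType) (A B X t V : R) :
  - (t / 4 * V) <= A -> X <= t / 4 * V -> A - X <= B -> - (t * V) <= B - t / 2 * V.
Proof. lra. Qed.

(** The [- 1 / 2] in the bound on [D] cancels [h * b * (V / 2)] up to [h^2 V / 4]. What remains is
    [2 m - q], and [q <= m + eta + Q] leaves [m - eta - Q]. *)
Lemma step_lower_bound (R : realType) (A V h b m eta Q q D : R) :
  h * b * (V / 2) * q <= h * b * (V / 2) * (m + eta + Q) -> 0 <= h ^+ 2 * V * m ->
  ((b + h) ^+ 2 - b ^+ 2) * V / 2 * (m - 1 / 2) <= D ->
  A + V * (h * b / 2 * (m - eta - Q)) - V * h ^+ 2 / 4
    <= A + h * b * (V / 2) * (1 - q) + D.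
Proof. lra. Qed.

Section planting.
Context {R : realType} (n : nat) {C : finType} (s : C -> nat -> R).
Hypothesis s_pm : forall c k, (k < n)%N -> s c k = 1 \/ s c k = -1.
Hypothesis n_gt0 : (0 < n)%N.
Context (op : C -> C -> C) (e : C).
Hypothesis s_op : forall c t k, (k < n)%N -> s (op c t) k = s c k * s t k.
Hypothesis s_e : forall k, (k < n)%N -> s e k = 1.
Hypothesis opK : forall c, involutive (op c).
Hypothesis op_inv : forall r c t, op (op r c) (op r t) = op c t.

Local Notation hm := (energy n s).
Local Notation Sw := (wsum n s).
Local Notation gav := (gibbs n s).
Local Notation gav2 := (gibbs2 n s).
Local Notation ov := (corr n s).

Implicit Types (L : pred C) (x : R) (c t : C) (v : vec R n).

Definition card_inv : R := #|C|%:R^-1.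

Lemma card_gt0R : 0 < #|C|%:R :> R.
Proof. by rewrite ltr0n; apply/card_gt0P; exists e. Qed.

Lemma card_inv_gt0 : 0 < card_inv.
Proof. by rewrite invr_gt0 card_gt0R. Qed.

Lemma card_inv_ge0 : 0 <= card_inv.
Proof. exact: ltW card_inv_gt0. Qed.

(** Density of the Gaussian vector translated by [x * s c] with respect to the original one; its
    mean is 1, and [Z] is the uniform average of these densities. *)
Definition W x c v : R := expR (x * hm c v - x ^+ 2 * n%:R / 2).

Definition wnull (x : R) (c : C) : R := card_inv * expR (- (x ^+ 2 * n%:R / 2)).

(** Weights seen after planting [e]: the shift of all couplings by [x] adds [x n (ov e c)] to the
    energy, while [1 / 2] is the normalization of [W]. The predicate [L] selects a layer of overlaps
    with the planted configuration. *)
Definition wpl (L : pred C) (x : R) (c : C) : R :=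
  card_inv * (L c)%:R * expR (x ^+ 2 * n%:R * (ov e c - 1 / 2)).

Definition Z x := Sw (wnull x) x.
Definition Zp L x := Sw (wpl L x) x.

(** The event is expressed through [op c t], on which alone the overlap depends ([ov_op]); this
    makes the quantity gauge invariant. *)
Definition otail (L : pred C) x :=
  gav2 (wnull x) x (fun c t => (L (op c t))%:R).

Lemma wnull_weights x : weights (wnull x).
Proof.
split; first by move=> c; rewrite mulr_ge0 ?expR_ge0// ltW// card_inv_gt0.
by exists e; rewrite mulr_gt0 ?expR_gt0// card_inv_gt0.
Qed.

Lemma wpl_weights L x : (exists c, L c) -> weights (wpl L x).
Proof.
move=> [c Lc]; split.
  by move=> c'; rewrite !mulr_ge0 ?expR_ge0// ltW// card_inv_gt0.
by exists c; rewrite /wpl Lc mulr1 mulr_gt0 ?expR_gt0// card_inv_gt0.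
Qed.

Lemma ov_op c t : ov c t = ov e (op c t).
Proof.
by rewrite /ov; congr (_ * _); apply: eq_bigr => k _; rewrite s_e// mul1r s_op.
Qed.

Lemma ov_e t : \sum_(k < n) s t k = n%:R * ov e t.
Proof.
rewrite /ov mulrA divff ?mul1r ?pnatr_eq0 -?lt0n//.
by apply: eq_bigr => k _; rewrite s_e// mul1r.
Qed.

Lemma ov_norm_le c t : `|ov c t| <= 1.
Proof.
rewrite /ov normrM normfV ler_pdivrMl ?normr_gt0 ?pnatr_eq0 -?lt0n// mulr1.
apply: le_trans (ler_norm_sum _ _ _) _.
rewrite normr_nat (eq_bigr (fun=> 1)) ?sumr_const ?card_ord//.
by move=> k _; rewrite normrM !(s_norm n s s_pm)// mulr1.
Qed.

Lemma ZE x v : Z x v = card_inv * \sum_c W x c v.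
Proof.
rewrite /Z /Sw mulr_sumr; apply: eq_bigr => c _.
by rewrite /wnull -mulrA -expRD addrC.
Qed.

Lemma W_vshift x c v :
  W x c (vshift n (fun=> x) v) = expR (x ^+ 2 * n%:R * ov e c) * W x c v.
Proof.
rewrite /W -expRD hm_vshift -mulr_suml ov_e; congr expR; ring.
Qed.

Lemma ZpE L x v : Zp L x v =
  card_inv * \sum_c (L c)%:R * W x c (vshift n (fun=> x) v).
Proof.
rewrite /Zp /Sw mulr_sumr; apply: eq_bigr => c _.
rewrite W_vshift /wpl /W -!mulrA; congr (_ * (_ * _)); rewrite -!expRD.
by congr expR; field.
Qed.

Lemma hm_vscale c t v : hm t (vscale n (s c) v) = hm (op c t) v.
Proof.
rewrite /energy; apply: eq_bigr => k _; rewrite crd_vscale// s_op//; ring.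
Qed.

Lemma W_vscale x c t v : W x t (vscale n (s c) v) = W x (op c t) v.
Proof. by rewrite /W hm_vscale. Qed.

Lemma tame_W x c : tame n (W x c).
Proof.
have := tameZ n (expR (- (x ^+ 2 * n%:R / 2))) _ (tame_exp_hm n s c x).
by congr tame; apply/funext => v; rewrite -expRD /W addrC.
Qed.

(** Weighting by [W x c] translates the disorder by [x * s c]. Flipping signs by [s c], which
    preserves the law, turns this into the uniform shift by [x] followed by a gauge
    transformation. *)
Lemma plant x c (psi : vec R n -> R) : tame n psi -> (forall v, 0 <= psi v) ->
  Ex n (fun v => W x c v * psi v) =
  Ex n (fun v => psi (vscale n (s c) (vshift n (fun=> x) v))).
Proof.
move=> tpsi psi0.
have sc k : (k < n)%N -> s c k = 1 \/ s c k = -1 by exact: s_pm.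
have := Ex_shift n (fun k => x * s c k) psi tpsi psi0.
have -> : (fun v => psi v * expR (\sum_(k < n) (x * s c k * crd n v k -
    (x * s c k) ^+ 2 / 2))) = (fun v => W x c v * psi v).
  apply/funext => v; rewrite mulrC /W /energy; congr (expR _ * _).
  rewrite mulr_sumr sumrB; congr (_ - _); first by apply: eq_bigr => k _; ring.
  rewrite (eq_bigr (fun=> x ^+ 2 / 2)); last first.
    by move=> k _; rewrite exprMn [s c k ^+ 2]expr2 (s_sqr n s s_pm)// mulr1.
  by rewrite sumr_const card_ord -mulr_natr; ring.
move=> <-.
have tS : tame n (fun v => psi (vshift n (fun k => x * s c k) v)).
  exact: (tame_vshift n (fun k => x * s c k)).
rewrite -(Ex_sign n (s c) _ sc tS)//; congr Ex; apply/funext => v; congr psi.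
have := sc; elim: {tpsi psi0 tS psi sc}n (s c) v => [|m IH] u v us //=.
congr (_, _); first by rewrite mulrDr [x * _]mulrC.
by apply: (IH (u \o S)) => k km; exact: us.
Qed.

Lemma sum_card_inv (z : R) : card_inv * \sum_(c : C) z = z.
Proof.
by rewrite sumr_const -mulr_natl mulrA mulVf ?mul1r// gt_eqF// card_gt0R.
Qed.

(** For gauge invariant [psi] all planted configurations give the same value, so averaging [plant]
    over [c] loses nothing. *)
Lemma plantZ x (psi : vec R n -> R) : tame n psi -> (forall v, 0 <= psi v) ->
  (forall c v, psi (vscale n (s c) v) = psi v) ->
  Ex n (fun v => Z x v * psi v) = Ex n (fun v => psi (vshift n (fun=> x) v)).
Proof.
move=> tpsi psi0 inv.
transitivity (card_inv * \sum_c Ex n (fun v => W x c v * psi v)).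
  rewrite -Ex_sum; last by move=> c _; apply: tameM => //; exact: tame_W.
  rewrite -ExZ; last by apply: tame_sum => c _; apply: tameM => //; exact: tame_W.
  by congr Ex; apply/funext => v; rewrite ZE -mulrA mulr_suml.
rewrite -[RHS]sum_card_inv; congr (_ * _); apply: eq_bigr => c _.
by rewrite plant//; congr Ex; apply/funext => v; rewrite inv.
Qed.

Lemma Z_vscale x c v : Z x (vscale n (s c) v) = Z x v.
Proof.
rewrite !ZE; congr (_ * _).
rewrite [RHS](reindex_inj (inv_inj (opK c))) /=.
by apply: eq_bigr => t _; rewrite W_vscale.
Qed.

Lemma Z_vshift x v : Z x (vshift n (fun=> x) v) = Zp xpredT x v.
Proof.
by rewrite ZE ZpE; congr (_ * _); apply: eq_bigr => t _; rewrite mul1r.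
Qed.

Lemma Z_gt0 x v : 0 < Z x v.
Proof. by apply: Sw_gt0; exact: wnull_weights. Qed.

Lemma tame_Z x : tame n (Z x).
Proof. exact: tame_Sw. Qed.

Lemma measurable_Z x : measurable_fun setT (Z x).
Proof. by case: (tame_Z x). Qed.

Lemma Ex_W x c : Ex n (W x c) = 1.
Proof.
rewrite -[RHS](Ex_cst n) -(plant x c (fun=> 1)) ?Ex_cst//; last exact: tame_cst.
by congr Ex; apply/funext => v; rewrite mulr1.
Qed.

Lemma Ex_Z x : Ex n (Z x) = 1.
Proof.
rewrite -[RHS](Ex_cst n) -(plantZ x (fun=> 1)) ?Ex_cst//; last exact: tame_cst.
by congr Ex; apply/funext => v; rewrite mulr1.
Qed.

Lemma Z_markov x (y : R) : 0 < y -> Ex n (fun v => (y < Z x v)%R%:R) <= y^-1.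
Proof.
move=> y0; have <- : Ex n (fun v => y^-1 * Z x v) = y^-1.
  by rewrite ExZ ?Ex_Z ?mulr1//; exact: tame_Z.
apply: Ex_le; first by apply: tame_bool; apply: measurable_fun_ltr => //; exact: measurable_Z.
  by apply: tameZ; exact: tame_Z.
move=> v; case: ltP => h /=; first by rewrite mulrC ler_pdivlMr// mul1r ltW.
by rewrite mulr_ge0 ?invr_ge0 ?ltW ?Z_gt0.
Qed.

(** Mass of the configurations whose overlap with [c] is in [L]; once [c] is planted it becomes
    [Zp L]. *)
Definition DL L x c v : R := card_inv * \sum_t W x t v * (L (op c t))%:R.

Lemma DL_vscale L x c v : DL L x c (vscale n (s c) (vshift n (fun=> x) v)) = Zp L x v.
Proof.
rewrite /DL ZpE; congr (_ * _).
rewrite [RHS](reindex_inj (inv_inj (opK c))) /=.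
by apply: eq_bigr => t _; rewrite W_vscale mulrC.
Qed.

Lemma tame_DL L x c : tame n (DL L x c).
Proof.
apply: tameZ; apply: tame_sum => t _; apply: tameM; [exact: tame_W|exact: tame_cst].
Qed.

Lemma otailE L x v :
  otail L x v = card_inv * (\sum_c W x c v * DL L x c v) / Z x v ^+ 2.
Proof.
have S0 : Z x v != 0 by rewrite gt_eqF// Z_gt0.
have wW c : wnull x c * expR (x * hm c v) = card_inv * W x c v.
  by rewrite /wnull -mulrA -expRD addrC.
rewrite /otail /gibbs2 {1}/gibbs expr2 invfM mulrA; congr (_ / _).
rewrite mulr_sumr mulr_suml; apply: eq_bigr => c _.
rewrite wW /gibbs -/(Z x) !mulrA; congr (_ / _).
rewrite /DL -!mulrA; congr (_ * (_ * _)); rewrite mulr_sumr.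
by apply: eq_bigr => t _; rewrite wW mulrA.
Qed.

Lemma DL_le L x c v : DL L x c v <= Z x v.
Proof.
rewrite ZE ler_wpM2l ?card_inv_ge0//; apply: ler_sum => t _.
by rewrite ler_piMr ?expR_ge0//; case: (L _).
Qed.

Lemma DL_ge0 L x c v : 0 <= DL L x c v.
Proof.
rewrite mulr_ge0 ?card_inv_ge0//; apply: sumr_ge0 => t _.
by rewrite mulr_ge0 ?expR_ge0.
Qed.

Lemma otail_ge0 L x v : 0 <= otail L x v.
Proof.
rewrite otailE divr_ge0 ?sqr_ge0// mulr_ge0 ?card_inv_ge0//.
by apply: sumr_ge0 => c _; rewrite mulr_ge0 ?expR_ge0 ?DL_ge0.
Qed.

Lemma otail_le1 L x v : otail L x v <= 1.
Proof.
rewrite otailE ler_pdivrMr ?exprn_gt0 ?Z_gt0// mul1r expr2 {1}ZE -mulrA.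
rewrite ler_wpM2l ?card_inv_ge0// mulr_suml; apply: ler_sum => c _.
by rewrite ler_wpM2l ?expR_ge0// DL_le.
Qed.

Lemma tame_otail L x : tame n (otail L x).
Proof. by apply: tame_gav2; exact: wnull_weights. Qed.

Lemma otail_vscale L x c v : otail L x (vscale n (s c) v) = otail L x v.
Proof.
rewrite !otailE Z_vscale; congr (_ * _ / _).
rewrite [RHS](reindex_inj (inv_inj (opK c))) /=.
apply: eq_bigr => t _; rewrite W_vscale; congr (_ * _); rewrite /DL; congr (_ * _).
rewrite [RHS](reindex_inj (inv_inj (opK c))) /=.
by apply: eq_bigr => t' _; rewrite W_vscale op_inv.
Qed.

Lemma measurable_Zp L x : measurable_fun setT (Zp L x).
Proof. by case: (tame_Sw n s (wpl L x) x). Qed.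

Lemma Zp_ge0 L x v : 0 <= Zp L x v.
Proof.
rewrite ZpE mulr_ge0 ?card_inv_ge0//; apply: sumr_ge0 => c _.
by rewrite mulr_ge0 ?expR_ge0.
Qed.

Lemma Zp_mono L x v : Zp L x v <= Zp xpredT x v.
Proof.
rewrite !ZpE ler_wpM2l ?card_inv_ge0//; apply: ler_sum => c _.
by rewrite ler_wpM2r ?expR_ge0//; case: (L c).
Qed.

Lemma tame_Zle x z0 : tame n (fun v => (Z x v <= z0)%R%:R).
Proof. by apply: tame_bool; apply: measurable_fun_ler => //; exact: measurable_Z. Qed.

(** Where [Z <= z0] the bound [otail <= 1] is used. Elsewhere each [DL / Z] is at most 1, and at
    most [y / z0] if [DL < y]; one remaining [1 / Z] is bounded by [1 / z0], and the factor [W x c]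
    plants the first replica. *)
Lemma otail_bound L x (z0 y : R) : 0 < z0 -> 0 <= y ->
  Ex n (otail L x) <= Ex n (fun v => (Z x v <= z0)%R%:R)
    + z0^-1 * (Ex n (fun v => (y <= Zp L x v)%R%:R) + y / z0).
Proof.
move=> z00 y0.
pose psi c v : R := z0^-1 * ((y <= DL L x c v)%R%:R + y / z0).
have tpsi c : tame n (psi c).
  apply: tameZ; apply: tameD; last exact: tame_cst.
  apply: tame_bool; apply: measurable_fun_ler => //; by case: (tame_DL L x c).
have psi0 c v : 0 <= psi c v.
  by rewrite mulr_ge0 ?invr_ge0 ?addr_ge0 ?divr_ge0// ltW.
have -> : z0^-1 * (Ex n (fun v => (y <= Zp L x v)%R%:R) + y / z0) =
    Ex n (fun v => card_inv * \sum_c W x c v * psi c v).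
  rewrite ExZ; last by apply: tame_sum => c _; apply: tameM => //; exact: tame_W.
  rewrite Ex_sum; last by move=> c _; apply: tameM => //; exact: tame_W.
  rewrite -[LHS]sum_card_inv; congr (_ * _); apply: eq_bigr => c _.
  have tb : tame n (fun v => (y <= Zp L x v)%R%:R).
    by apply: tame_bool; apply: measurable_fun_ler => //; exact: measurable_Zp.
  rewrite plant// /psi -[y / z0](Ex_cst n) -ExD//; last exact: tame_cst.
  rewrite -ExZ; last by apply: tameD => //; exact: tame_cst.
  by congr Ex; apply/funext => v; rewrite DL_vscale Ex_cst.
have tR : tame n (fun v => card_inv * \sum_c W x c v * psi c v).
  by apply: tameZ; apply: tame_sum => c _; apply: tameM => //; exact: tame_W.
rewrite -ExD//; last exact: tame_Zle.
apply: Ex_le; first exact: tame_otail.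
  by apply: tameD => //; exact: tame_Zle.
move=> v; case: (leP (Z x v) z0) => h /=.
  apply: (@le_trans _ _ 1); first exact: otail_le1.
  rewrite lerDl mulr_ge0 ?card_inv_ge0//; apply: sumr_ge0 => c _.
  by rewrite mulr_ge0 ?expR_ge0.
rewrite add0r otailE -mulrA ler_wpM2l ?card_inv_ge0// mulr_suml.
apply: ler_sum => c _; rewrite -mulrA ler_wpM2l ?expR_ge0//.
have Z0 := Z_gt0 x v.
rewrite expr2 invfM mulrA mulrC /psi; apply: ler_pM.
- by rewrite invr_ge0 ltW.
- by rewrite divr_ge0 ?DL_ge0// ltW.
- by rewrite lef_pV2 ?posrE// ltW.
case: (leP y (DL L x c v)) => hy /=.
  apply: (@le_trans _ _ 1); first by rewrite ler_pdivrMr// mul1r DL_le.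
  by rewrite lerDl divr_ge0// ltW.
rewrite add0r; apply: ler_pM; [exact: DL_ge0| |exact: ltW|].
  by rewrite invr_ge0 ltW.
by rewrite lef_pV2 ?posrE// ltW.
Qed.

(** Between [z0] and [y] the indicator is at most [Z / z0], and [E Z 1{Z <= y}] is the probability
    that the planted sum is at most [y]. Above [y], Markov applies since [E Z = 1]. *)
Lemma planted_mass_bound x (z0 y : R) : 0 < z0 -> 0 < y ->
  1 <= Ex n (fun v => (Z x v <= z0)%R%:R) + y^-1
     + z0^-1 * Ex n (fun v => (Zp xpredT x v <= y)%R%:R).
Proof.
move=> z00 y0.
have t1 := tame_Zle x z0; have t3 := tame_Zle x y.
have t2 : tame n (fun v => (y < Z x v)%R%:R).
  by apply: tame_bool; apply: measurable_fun_ltr => //; exact: measurable_Z.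
have t4 : tame n (fun v => Z x v * (Z x v <= y)%R%:R).
  by apply: tameM => //; exact: tame_Z.
apply: (@le_trans _ _ (Ex n (fun v => (Z x v <= z0)%R%:R) +
  Ex n (fun v => (y < Z x v)%R%:R)
  + z0^-1 * Ex n (fun v => Z x v * (Z x v <= y)%R%:R))); last first.
  apply: lerD; first by rewrite lerD2l Z_markov.
  apply: ler_wpM2l; first by rewrite invr_ge0 ltW.
  rewrite (plantZ x _ t3); [|by move=> v|by move=> c v; rewrite Z_vscale].
  rewrite le_eqVlt; apply/orP; left; apply/eqP; congr Ex; apply/funext => v.
  by rewrite Z_vshift.
have t5 := tameZ n z0^-1 _ t4; have t6 := tameD n _ _ t1 t2.
rewrite -ExZ// -ExD// -ExD//.
rewrite -[leLHS](Ex_cst n); apply: Ex_le; first exact: tame_cst.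
  by apply: tameD; [exact: tameD|exact: tameZ].
move=> v; have Z0 := Z_gt0 x v.
have p0 (b : bool) : 0 <= z0^-1 * (Z x v * b%:R).
  by rewrite mulr_ge0 ?invr_ge0 ?mulr_ge0// ltW.
case: (leP (Z x v) z0) => h1; case: (ltP y (Z x v)) => h2.
- by have := p0 false; rewrite /=; lra.
- by have := p0 true; rewrite /=; lra.
- by have := p0 false; rewrite /=; lra.
- by rewrite !add0r mulr1 mulrC ler_pdivlMr// mul1r ltW.
Qed.

(** Off the two exceptional events the pair average of the layer is at most [(y2 / y1)^2] times
    [otail] at the shifted disorder. Undoing the shift brings a factor [Z < y2], whence the cube. *)
Lemma planted_pair_bound L L' x (y1 y2 : R) : (exists c, L c) ->
  0 < y1 -> 0 < y2 ->
  Ex n (gav2 (wpl L x) x (fun c t => (L' (op c t))%:R)) <=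
  Ex n (fun v => (Zp L x v <= y1)%R%:R) + Ex n (fun v => (y2 <= Zp xpredT x v)%R%:R)
  + y2 ^+ 3 / y1 ^+ 2 * Ex n (otail L' x).
Proof.
move=> L0 y10 y20; have wL := wpl_weights L x L0.
have t1 : tame n (fun v => (Zp L x v <= y1)%R%:R).
  by apply: tame_bool; apply: measurable_fun_ler => //; exact: measurable_Zp.
have t2 : tame n (fun v => (y2 <= Zp xpredT x v)%R%:R).
  by apply: tame_bool; apply: measurable_fun_ler => //; exact: measurable_Zp.
pose psi v : R := (Z x v < y2)%R%:R * otail L' x v.
have tpsi : tame n psi.
  apply: tameM; last exact: tame_otail.
  by apply: tame_bool; apply: measurable_fun_ltr => //; exact: measurable_Z.
have psi0 v : 0 <= psi v by rewrite mulr_ge0// otail_ge0.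
have tps : tame n (fun v => psi (vshift n (fun=> x) v)) by exact: tame_vshift.
apply: (@le_trans _ _ (Ex n (fun v => (Zp L x v <= y1)%R%:R) +
   Ex n (fun v => (y2 <= Zp xpredT x v)%R%:R)
  + y2 ^+ 2 / y1 ^+ 2 * Ex n (fun v => psi (vshift n (fun=> x) v)))); last first.
  rewrite lerD2l (exprSr y2 2) -[y2 ^+ 2 * y2 / _]mulrAC -[leRHS]mulrA.
  rewrite ler_wpM2l ?divr_ge0 ?sqr_ge0// -plantZ//; last first.
    by move=> c v; rewrite /psi Z_vscale otail_vscale.
  rewrite -ExZ; last exact: tame_otail.
  apply: Ex_le; [|by apply: tameZ; exact: tame_otail|].
    by apply: tameM => //; exact: tame_Z.
  move=> v; rewrite /psi mulrA ler_wpM2r ?otail_ge0//.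
  by case: ltP => h /=; rewrite ?mulr1 ?mulr0 ltW.
have t5 := tameZ n (y2 ^+ 2 / y1 ^+ 2) _ tps; have t6 := tameD n _ _ t1 t2.
rewrite -ExZ// -ExD// -ExD//.
apply: Ex_le; first exact: tame_gav2.
  by apply: tameD; [exact: tameD|exact: tameZ].
move=> v.
have le1 : gav2 (wpl L x) x (fun c t => (L' (op c t))%:R) v <= 1.
  rewrite /gibbs2 -[leRHS](gav_cst n s _ x _ v wL); apply: gav_le => // c _.
  rewrite -[leRHS](gav_cst n s _ x _ v wL); apply: gav_le => // t _.
  by case: (L' _).
have p0 : 0 <= y2 ^+ 2 / y1 ^+ 2 * psi (vshift n (fun=> x) v).
  by rewrite mulr_ge0// divr_ge0// sqr_ge0.
case: (leP (Zp L x v) y1) => h1; case: (leP y2 (Zp xpredT x v)) => h2 /=;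
  [by lra|by lra|by lra|].
rewrite !add0r /psi Z_vshift h2 mul1r.
set u := vshift n (fun=> x) v.
have Zp0 : 0 < Zp L x v by lra.
have ZT0 : 0 < Z x u by exact: Z_gt0.
have wW c : wpl L x c * expR (x * hm c v) = card_inv * ((L c)%:R * W x c u).
  rewrite /u W_vshift /wpl /W -!mulrA; congr (_ * (_ * _)); rewrite -!expRD.
  by congr expR; field.
have -> : gav2 (wpl L x) x (fun c t => (L' (op c t))%:R) v =
    (card_inv * \sum_c (L c)%:R * W x c u *
       (card_inv * \sum_t (L t)%:R * W x t u * (L' (op c t))%:R)) / Zp L x v ^+ 2.
  rewrite /gibbs2 {1}/gibbs expr2 invfM mulrA; congr (_ / _).
  rewrite mulr_sumr mulr_suml; apply: eq_bigr => c _.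
  rewrite wW /gibbs -/(Zp L x) !mulrA; congr (_ / _).
  rewrite -!mulrA; congr (_ * (_ * (_ * _))); rewrite mulr_sumr.
  by apply: eq_bigr => t _; rewrite wW !mulrA.
have num : card_inv * \sum_c (L c)%:R * W x c u *
       (card_inv * \sum_t (L t)%:R * W x t u * (L' (op c t))%:R)
    <= Z x u ^+ 2 * otail L' x u.
  rewrite otailE [leRHS]mulrC divfK; last by rewrite expf_neq0// gt_eqF.
  rewrite ler_wpM2l ?card_inv_ge0//; apply: ler_sum => c _.
  apply: ler_pM.
  - by rewrite mulr_ge0 ?expR_ge0.
  - rewrite mulr_ge0 ?card_inv_ge0//; apply: sumr_ge0 => t _.
    by rewrite !mulr_ge0 ?expR_ge0.
  - by rewrite ler_piMl ?expR_ge0//; case: (L c).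
  rewrite /DL ler_wpM2l ?card_inv_ge0//; apply: ler_sum => t _.
  by rewrite ler_wpM2r// ler_piMl ?expR_ge0//; case: (L t).
rewrite [leRHS]mulrAC; apply: ler_pM; [|by rewrite invr_ge0 sqr_ge0|..].
- rewrite mulr_ge0 ?card_inv_ge0//; apply: sumr_ge0 => c _.
  rewrite mulr_ge0 ?mulr_ge0 ?expR_ge0 ?card_inv_ge0//; apply: sumr_ge0 => t _.
  by rewrite !mulr_ge0 ?expR_ge0.
- apply: le_trans num _; rewrite ler_wpM2r ?otail_ge0//.
  rewrite lerXn2r ?nnegrE ?ltW//; by move: h2; rewrite -Z_vshift.
- by rewrite lef_pV2 ?posrE ?exprn_gt0// lerXn2r ?nnegrE ?ltW.
Qed.

(** Since [E W = 1], the configuration [c] contributes exactly [exp (x^2 n (ov e c))]: the first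
    moment under planting is the second moment of the original weights. *)
Lemma Ex_Zp_le L x (z : R) : (forall c, L c -> ov e c <= z) ->
  Ex n (Zp L x) <= expR (x ^+ 2 * n%:R * z).
Proof.
move=> Lz.
have -> : Ex n (Zp L x) =
    card_inv * \sum_c (L c)%:R * expR (x ^+ 2 * n%:R * ov e c).
  transitivity (Ex n (fun v => card_inv * \sum_c
      ((L c)%:R * expR (x ^+ 2 * n%:R * ov e c)) * W x c v)).
    congr Ex; apply/funext => v; rewrite ZpE; congr (_ * _); apply: eq_bigr => c _.
    by rewrite W_vshift mulrA.
  rewrite ExZ; last by apply: tame_sum => c _; apply: tameZ; exact: tame_W.
  rewrite Ex_sum; last by move=> c _; apply: tameZ; exact: tame_W.
  congr (_ * _); apply: eq_bigr => c _.
  by rewrite ExZ ?Ex_W ?mulr1//; exact: tame_W.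
rewrite -[leRHS]sum_card_inv ler_wpM2l ?card_inv_ge0//; apply: ler_sum => c _.
case: (boolP (L c)) => Lc; last by rewrite mul0r expR_ge0.
by rewrite mul1r ler_expR ler_wpM2l ?Lz// mulr_ge0 ?sqr_ge0.
Qed.

(* [theta] is the normalisation of the couplings, so that [beta * theta] is
   the coefficient of [energy] in the Gibbs weight, and [V] is the volume. *)
Context (theta V b0 : R).
Hypothesis theta_gt0 : 0 < theta.
Hypothesis V_gt0 : 0 < V.
Hypothesis theta2 : theta ^+ 2 * n%:R = V / 2.
Hypothesis b0_gt0 : 0 < b0.

(** A deviation [t V] against the variance proxy [b0^2 V / 2] gives the Chernoff exponent
    [rate t * V], uniformly in [b <= b0]. *)
Definition rate (t : R) := t ^+ 2 / (2 * b0 ^+ 2).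

Lemma Sw_upper_tail a b (t y : R) : weights a -> 0 < b <= b0 -> 0 <= t ->
  Ex n (fun v => ln (Sw a (b * theta) v)) + t * V <= y ->
  Ex n (fun v => (expR y <= Sw a (b * theta) v)%R%:R) <= expR (- (rate t * V)).
Proof.
move=> wa /andP[b_gt0 bb0] t0 ty.
have x0 : 0 <= b * theta by rewrite mulr_ge0 ?ltW.
set f := fun v => ln _ in ty *.
have mf : measurable_fun setT f by exact: measurable_lnSw.
have lf : lipschitz n (b * theta) f by exact: (lnSw_lipschitz n s s_pm).
have D0 : 0 < b0 ^+ 2 * V / 2 by rewrite !mulr_gt0 ?exprn_gt0.
have nD : n%:R * (b * theta) ^+ 2 <= b0 ^+ 2 * V / 2.
  rewrite exprMn mulrCA [n%:R * _]mulrC theta2 -mulrA ler_wpM2r//.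
    by rewrite divr_ge0// ltW.
  by rewrite lerXn2r ?nnegrE// ltW.
have tV0 : 0 <= t * V by rewrite mulr_ge0// ltW.
have := lipschitz_upper_tail n _ _ _ f mf lf D0 nD tV0.
rewrite (_ : (t * V) ^+ 2 / (4 * (b0 ^+ 2 * V / 2)) = rate t * V); last first.
  by rewrite /rate; field; rewrite !gt_eqF.
apply: le_trans; apply: Ex_le.
- by apply: tame_bool; apply: measurable_fun_ler => //; case: (tame_Sw n s a (b * theta)).
- by apply: tame_bool; exact: measurable_fun_ler.
- move=> v; have S0 := Sw_gt0 n s a (b * theta) v wa.
  case: (leP (expR y) _) => // h; rewrite (_ : _ <= f v)//.
  by apply: le_trans ty _; rewrite -[y]expRK ler_ln ?posrE ?expR_gt0.
Qed.

Lemma Sw_lower_tail a b (t y : R) : weights a -> 0 < b <= b0 -> 0 <= t ->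
  y <= Ex n (fun v => ln (Sw a (b * theta) v)) - t * V ->
  Ex n (fun v => (Sw a (b * theta) v <= expR y)%R%:R) <= expR (- (rate t * V)).
Proof.
move=> wa /andP[b_gt0 bb0] t0 ty.
have x0 : 0 <= b * theta by rewrite mulr_ge0 ?ltW.
set f := fun v => ln _ in ty *.
have mf : measurable_fun setT f by exact: measurable_lnSw.
have lf : lipschitz n (b * theta) f by exact: (lnSw_lipschitz n s s_pm).
have D0 : 0 < b0 ^+ 2 * V / 2 by rewrite !mulr_gt0 ?exprn_gt0.
have nD : n%:R * (b * theta) ^+ 2 <= b0 ^+ 2 * V / 2.
  rewrite exprMn mulrCA [n%:R * _]mulrC theta2 -mulrA ler_wpM2r//.
    by rewrite divr_ge0// ltW.
  by rewrite lerXn2r ?nnegrE// ltW.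
have tV0 : 0 <= t * V by rewrite mulr_ge0// ltW.
have := lipschitz_lower_tail n _ _ _ f mf lf D0 nD tV0.
rewrite (_ : (t * V) ^+ 2 / (4 * (b0 ^+ 2 * V / 2)) = rate t * V); last first.
  by rewrite /rate; field; rewrite !gt_eqF.
apply: le_trans; apply: Ex_le.
- by apply: tame_bool; apply: measurable_fun_ler => //; case: (tame_Sw n s a (b * theta)).
- by apply: tame_bool; exact: measurable_fun_ler.
- move=> v; have S0 := Sw_gt0 n s a (b * theta) v wa.
  case: (leP _ (expR y)) => // h; rewrite (_ : f v <= _)//.
  by apply: le_trans ty; rewrite -[y]expRK ler_ln ?posrE ?expR_gt0.
Qed.

(** * Increments in beta of the expected log-partition functions *)

Definition lZ b := Ex n (fun v => ln (Z (b * theta) v)).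
Definition lZp L b := Ex n (fun v => ln (Zp L (b * theta) v)).

(** The derivative of [lZ] is [- b V / 2] times a nonnegative two-replica mean, so [lZ] does not
    increase with beta; the tangent estimate over a finite step loses only a quadratic term. *)
Lemma lZ_step b b' : 0 < b' <= b -> lZ b - (b - b') ^+ 2 * V / 4 <= lZ b'.
Proof.
move=> /andP[b'0 b'b].
have b_gt0 : 0 < b by exact: lt_le_trans b'b.
have wa := wnull_weights (b * theta).
have x0 : 0 < b * theta by rewrite mulr_gt0.
have y0 : 0 <= b' * theta by rewrite mulr_ge0 ?ltW.
pose d (c : C) := (b ^+ 2 - b' ^+ 2) * V / 4.
have := Ex_lnSw_convex n s s_pm _ d _ _ wa x0 y0 n_gt0.
have -> : (fun c => wnull (b * theta) c * expR (d c)) = wnull (b' * theta).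
  apply/funext => c; rewrite /wnull -mulrA -expRD; congr (_ * expR _).
  rewrite /d (_ : V = 2 * (theta ^+ 2 * n%:R)); last by rewrite theta2; field.
  by field.
rewrite -/(Z (b * theta)) -/(lZ b) -/(lZ b').
have -> : Ex n (gav (wnull (b * theta)) (b * theta) d) = (b ^+ 2 - b' ^+ 2) * V / 4.
  by rewrite -[RHS](Ex_cst n); congr Ex; apply/funext => v; rewrite gav_cst.
set q := Ex n (gav2 _ _ _).
have q0 : 0 <= q by apply: Ex_ge0 => v; exact: gav2_ov_ge0.
apply: le_trans.
have -> : (b' * theta - b * theta) * (b * theta * n%:R * (1 - q)) =
    (b' - b) * b * (V / 2) * (1 - q) by rewrite -theta2; ring.
have : 0 <= (b - b') * b * (V / 2) * q.
  by rewrite !mulr_ge0 ?subr_ge0 ?divr_ge0// ltW.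
nra.
Qed.

(** Cutting the interval into [m] equal steps divides the accumulated quadratic loss by [m]. *)
Lemma lZ_monotone b m : 0 < b <= b0 -> (0 < m)%N ->
  lZ b0 - b0 ^+ 2 * V / (4 * m%:R) <= lZ b.
Proof.
move=> /andP[b_gt0 bb0] m0.
have mR : 0 < m%:R :> R by rewrite ltr0n.
have [h h0 mh] : exists2 h, 0 <= h & m%:R * h = b0 - b.
  exists ((b0 - b) / m%:R); first by rewrite divr_ge0 ?subr_ge0// ltW.
  by rewrite mulrC divfK// gt_eqF.
have grid j : (j <= m)%N -> lZ b0 - j%:R * (h ^+ 2 * V / 4) <= lZ (b0 - j%:R * h).
  elim: j => [|j IH] jm; first by rewrite !mul0r !subr0.
  have jh : j.+1%:R * h <= b0 - b by rewrite -mh ler_wpM2r// ler_nat.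
  have hj : 0 < b0 - j.+1%:R * h <= b0 - j%:R * h.
    apply/andP; split; last by rewrite lerD2l lerN2 ler_wpM2r// ler_nat.
    by rewrite subr_gt0 (le_lt_trans jh)// ltrBlDr ltrDl.
  apply: le_trans (lZ_step _ _ hj); rewrite lerBrDr.
  apply: le_trans (IH (ltnW jm)); rewrite le_eqVlt; apply/orP; left; apply/eqP.
  by rewrite -natr1; field.
have := grid m (leqnn m); rewrite mh subKr.
apply: le_trans; rewrite lerD2l lerN2.
rewrite (_ : m%:R * (h ^+ 2 * V / 4) = (m%:R * h) ^+ 2 * V / (4 * m%:R)); last first.
  by field; rewrite gt_eqF.
rewrite mh ler_wpM2r ?invr_ge0 ?mulr_ge0 ?(ltW mR)// ler_wpM2r ?(ltW V_gt0)//.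
by rewrite lerXn2r ?nnegrE ?subr_ge0// ?(ltW b0_gt0)// lerBlDr lerDl ltW.
Qed.

Lemma Z_lower_tail b (t : R) : 0 < b <= b0 -> 0 < t -> - (t / 4 * V) <= lZ b0 ->
  Ex n (fun v => (Z (b * theta) v <= expR (- (t * V)))%R%:R)
    <= expR (- (rate (t / 2) * V)).
Proof.
move=> bb0 t0 l0.
apply: Sw_lower_tail => //; first exact: wnull_weights.
  by rewrite divr_ge0// ltW.
(* Enough steps to make the loss at most [t V / 4]. With the assumed [t V / 4] at [b0], half of
   [t V] is left for the deviation. *)
pose m := (Num.truncn (b0 ^+ 2 / t)).+1.
have mb : b0 ^+ 2 / t < m%:R by rewrite truncnS_gt.
have mR : 0 < m%:R :> R by rewrite ltr0n.
have := lZ_monotone b m bb0 isT.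
have : b0 ^+ 2 * V / (4 * m%:R) <= t / 4 * V.
  rewrite ler_pdivrMr ?mulr_gt0//.
  move: mb; rewrite ltr_pdivrMr// => mb.
  have : b0 ^+ 2 * V <= m%:R * t * V by rewrite ler_wpM2r ?(ltW V_gt0)// ltW.
  by lra.
by move=> hX; exact: drop_lower_bound l0 hX.
Qed.

(** Inside [L] the planted bias is at least its value at overlap [m], while two replicas have
    overlap at most [m + eta], except on pairs in [L'], where 1 is the trivial bound. The gain is
    linear in [h] and the loss quadratic. *)
Lemma lZp_step L (L' : pred C) (m eta b h : R) : (exists c, L c) ->
  (forall c, L c -> m <= ov e c) -> (forall c, ~~ L' c -> ov e c <= m + eta) ->
  0 <= m -> 0 <= eta -> 0 < b -> 0 < h ->
  lZp L b + V * (h * b / 2 * (m - eta -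
     Ex n (gav2 (wpl L (b * theta)) (b * theta) (fun c t => (L' (op c t))%:R))))
   - V * h ^+ 2 / 4 <= lZp L (b + h).
Proof.
move=> L0 Lm L'm m0 eta0 b_gt0 h0.
have wa := wpl_weights L (b * theta) L0.
have x0 : 0 < b * theta by rewrite mulr_gt0.
have y0 : 0 <= (b + h) * theta by rewrite mulr_ge0 ?ltW// addr_gt0.
pose d (c : C) := ((b + h) ^+ 2 - b ^+ 2) * V / 2 * (ov e c - 1 / 2).
have := Ex_lnSw_convex n s s_pm _ d _ _ wa x0 y0 n_gt0.
have -> : (fun c => wpl L (b * theta) c * expR (d c)) = wpl L ((b + h) * theta).
  apply/funext => c; rewrite /wpl -mulrA -expRD; congr (_ * expR _).
  rewrite /d (_ : V = 2 * (theta ^+ 2 * n%:R)); last by rewrite theta2; field.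
  by field.
rewrite -/(Zp L (b * theta)) -/(lZp L b) -/(lZp L (b + h)).
set q := Ex n (gav2 _ _ ov); set Q := Ex n (gav2 _ _ (fun c t => (L' _)%:R)).
have dm : ((b + h) ^+ 2 - b ^+ 2) * V / 2 * (m - 1 / 2)
    <= Ex n (gav (wpl L (b * theta)) (b * theta) d).
  rewrite -[leLHS](Ex_cst n); apply: Ex_le; [exact: tame_cst|exact: tame_gav|] => v.
  rewrite -[leLHS](gav_cst n s _ (b * theta) _ v wa); apply: gav_le => // c.
  move=> wc; rewrite /d ler_wpM2l//.
    rewrite divr_ge0// mulr_ge0// ?(ltW V_gt0)//; nra.
  rewrite lerD2r; apply: Lm; move: wc; rewrite /wpl.
  by case: (L c) => //; rewrite mulr0 mul0r ltxx.
have qQ : q <= m + eta + Q.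
  rewrite -[m + eta](Ex_cst n) -ExD; [|exact: tame_cst|exact: tame_gav2].
  apply: Ex_le; first exact: tame_gav2.
    by apply: tameD; [exact: tame_cst|exact: tame_gav2].
  move=> v; rewrite -[m + eta](gav_cst n s _ (b * theta) _ v wa) /gibbs2 -gavD.
  apply: gav_le => // c _.
  rewrite -[m + eta](gav_cst n s _ (b * theta) _ v wa) -gavD.
  apply: gav_le => // t _. rewrite ov_op.
  case: (boolP (L' (op c t))) => hL /=; last by rewrite addr0 L'm.
  have := ov_norm_le e (op c t); rewrite ler_norml => /andP[_]; lra.
apply: le_trans.
have -> : ((b + h) * theta - b * theta) * (b * theta * n%:R * (1 - q)) =
    h * b * (V / 2) * (1 - q) by rewrite -theta2; ring.
have hq : h * b * (V / 2) * q <= h * b * (V / 2) * (m + eta + Q).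
  by rewrite ler_wpM2l// !mulr_ge0 ?(ltW V_gt0) ?(ltW h0) ?(ltW b_gt0).
have mh : 0 <= h ^+ 2 * V * m.
  by rewrite mulr_ge0// mulr_ge0 ?sqr_ge0// ltW.
exact: step_lower_bound hq mh dm.
Qed.

End planting.

Arguments rate {R}.

(** * Exponential smallness of the overlap *)

(** The spins form a group of signs with product [op] and unit [e], acting on the couplings by gauge
    transformations. Bundling the data allows statements about a sequence of systems of growing
    volume. *)
Record spin_system (R : realType) := SpinSystem {
  ss_n : nat;
  ss_C : finType;
  ss_s : ss_C -> nat -> R;
  ss_op : ss_C -> ss_C -> ss_C;
  ss_e : ss_C;
  ss_theta : R;
  ss_V : R;
  ss_pm : forall c k, (k < ss_n)%N -> ss_s c k = 1 \/ ss_s c k = -1;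
  ss_n_gt0 : (0 < ss_n)%N;
  ss_s_op : forall c t k, (k < ss_n)%N -> ss_s (ss_op c t) k = ss_s c k * ss_s t k;
  ss_s_e : forall k, (k < ss_n)%N -> ss_s ss_e k = 1;
  ss_opK : forall c, involutive (ss_op c);
  ss_op_inv : forall r c t, ss_op (ss_op r c) (ss_op r t) = ss_op c t;
  ss_theta_gt0 : 0 < ss_theta;
  ss_V_gt0 : 0 < ss_V;
  ss_theta2 : ss_theta ^+ 2 * ss_n%:R = ss_V / 2 }.

Section one_system.
Context {R : realType} (S : spin_system R).
Local Notation n := (ss_n R S).
Local Notation C := (ss_C R S).
Local Notation s := (ss_s R S).
Local Notation op := (ss_op R S).
Local Notation e := (ss_e R S).
Local Notation theta := (ss_theta R S).
Local Notation V := (ss_V R S).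
Let pm := ss_pm R S.
Let n0 := ss_n_gt0 R S.
Let sop := ss_s_op R S.
Let se := ss_s_e R S.
Let opK := ss_opK R S.
Let opi := ss_op_inv R S.
Let th0 := ss_theta_gt0 R S.
Let V0 := ss_V_gt0 R S.
Let th2 := ss_theta2 R S.
Implicit Types (L : pred C) (b y t : R).

Definition sov (c : C) : R := corr n s e c.
Definition freeZ b := lZ n s theta b.
Definition freeZp L b := lZp n s e theta L b.
(** Thresholds are written as exponentials so that the later estimates only compare exponents. *)
Definition probZ_le b y := Ex n (fun v => (Z n s (b * theta) v <= expR y)%R%:R).
Definition probZp_le L b y := Ex n (fun v => (Zp n s e L (b * theta) v <= expR y)%R%:R).
Definition probZp_ge L b y := Ex n (fun v => (expR y <= Zp n s e L (b * theta) v)%R%:R).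
Definition mtail L b := Ex n (otail n s op L (b * theta)).
Definition mpair L L' b := Ex n (gibbs2 n s (wpl n s e L (b * theta)) (b * theta)
  (fun c c' => (L' (op c c'))%:R)).

Lemma mtail_bound L b t y : mtail L b <=
  probZ_le b (- t) + expR t * (probZp_ge L b y + expR (y + t)).
Proof.
have := otail_bound n s pm n0 op e sop se opK L (b * theta) (expR (- t)) (expR y)
  (expR_gt0 _) (expR_ge0 _).
by rewrite -[(expR (- t))^-1]expRN opprK expRD.
Qed.

Lemma mass_bound b t y : 1 <=
  probZ_le b (- t) + expR (- y) + expR t * probZp_le xpredT b y.
Proof.
have := planted_mass_bound n s pm n0 op e sop se opK (b * theta) (expR (- t)) (expR y)
  (expR_gt0 _) (expR_gt0 _).
by rewrite -[(expR (- t))^-1]expRN opprK -expRN.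
Qed.

Lemma mpair_bound L L' b y1 y2 : (exists c, L c) -> mpair L L' b <=
  probZp_le L b y1 + probZp_ge xpredT b y2
  + expR (3 * y2 - 2 * y1) * mtail L' b.
Proof.
move=> L0.
have := planted_pair_bound n s pm n0 op e sop se opK opi L L' (b * theta)
  (expR y1) (expR y2) L0 (expR_gt0 _) (expR_gt0 _).
by rewrite -!expRM_natl -expRB.
Qed.

Lemma mtail_ge0 L b : 0 <= mtail L b.
Proof. by apply: Ex_ge0 => v; exact: (otail_ge0 n s op e). Qed.

Lemma mtail_le1 L b : mtail L b <= 1.
Proof.
rewrite -[leRHS](Ex_cst n); apply: Ex_le; [exact: (tame_otail n s op e)|exact: tame_cst|].
by move=> v; exact: (otail_le1 n s op e).
Qed.

Lemma mtail0 L b : (forall c, ~~ L c) -> mtail L b = 0.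
Proof.
move=> L0; rewrite -[RHS](Ex_cst n); congr Ex; apply/funext => v.
have w := @wnull_weights R n C e (b * theta).
rewrite /otail /gibbs2 (_ : (fun c => _) = fun=> 0) ?gav_cst//.
apply/funext => c; rewrite (_ : (fun c' => _) = fun=> 0) ?gav_cst//.
by apply/funext => t; rewrite (negbTE (L0 _)).
Qed.

Lemma mtailD L L1 L2 b : (forall c, L c -> L1 c || L2 c) ->
  mtail L b <= mtail L1 b + mtail L2 b.
Proof.
move=> L12; have w := @wnull_weights R n C e (b * theta).
rewrite -ExD; [|exact: (tame_otail n s op e)|exact: (tame_otail n s op e)].
apply: Ex_le; first exact: (tame_otail n s op e).
  by apply: tameD; exact: (tame_otail n s op e).
move=> v; rewrite /otail /gibbs2 -gavD; apply: gav_le => // c _.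
rewrite -gavD; apply: gav_le => // t _.
case: (boolP (L _)) => hL; last by rewrite addr_ge0.
have := L12 _ hL; case: (L1 _) => /= [_|->]; first by rewrite lerDl.
by rewrite add0r.
Qed.

Lemma freeZp_mono L b : 0 < b -> (exists c, L c) -> freeZp L b <= freeZp xpredT b.
Proof.
move=> b0 L0; have x0 : 0 <= b * theta by rewrite mulr_ge0 ?ltW.
have w1 := wpl_weights n s e L (b * theta) L0.
have w2 : weights (wpl n s e xpredT (b * theta)) by apply: wpl_weights; exists e.
apply: Ex_le; [exact: (tame_lnSw n s pm)|exact: (tame_lnSw n s pm)|].
move=> v; rewrite ler_ln ?posrE; try exact: Sw_gt0.
exact: Zp_mono.
Qed.

Lemma probZp_le_tail L b0 b t y : (exists c, L c) -> 0 < b0 -> 0 < b <= b0 ->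
  0 <= t -> y <= freeZp L b - t * V -> probZp_le L b y <= expR (- (rate b0 t * V)).
Proof.
move=> L0 b00 bb0 t0 h.
exact: (Sw_lower_tail n s pm theta V b0 th0 V0 th2 b00 _ _ _ _ (wpl_weights _ _ _ _ _ L0)).
Qed.

Lemma probZp_ge_tail L b0 b t y : (exists c, L c) -> 0 < b0 -> 0 < b <= b0 ->
  0 <= t -> freeZp L b + t * V <= y -> probZp_ge L b y <= expR (- (rate b0 t * V)).
Proof.
move=> L0 b00 bb0 t0 h.
exact: (Sw_upper_tail n s pm theta V b0 th0 V0 th2 b00 _ _ _ _ (wpl_weights _ _ _ _ _ L0)).
Qed.

Lemma probZ_le_tail b0 b t : 0 < b0 -> 0 < b <= b0 -> 0 < t ->
  - (t / 4 * V) <= freeZ b0 ->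
  probZ_le b (- (t * V)) <= expR (- (rate b0 (t / 2) * V)).
Proof.
move=> b00 bb0 t0 h.
exact: (Z_lower_tail n s pm n0 e theta V b0 th0 V0 th2 b00 b t bb0 t0 h).
Qed.

Lemma freeZp_step L L' m eta b h : (exists c, L c) ->
  (forall c, L c -> m <= sov c) -> (forall c, ~~ L' c -> sov c <= m + eta) ->
  0 <= m -> 0 <= eta -> 0 < b -> 0 < h ->
  freeZp L b + V * (h * b / 2 * (m - eta - mpair L L' b)) - V * h ^+ 2 / 4
  <= freeZp L (b + h).
Proof.
exact: (lZp_step n s pm n0 op e sop se theta V th0 V0 th2).
Qed.

Lemma probZp_ge_markov L b z y : (forall c, L c -> sov c <= z) ->
  probZp_ge L b y <= expR (b ^+ 2 * V / 2 * z - y).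
Proof.
move=> Lz; have := Ex_Zp_le n s pm n0 e se L (b * theta) z Lz.
have -> : (b * theta) ^+ 2 * n%:R = b ^+ 2 * V / 2.
  by rewrite -[RHS]mulrA -th2; ring.
move=> h.
have tZ : tame n (Zp n s e L (b * theta)) by exact: tame_Sw.
rewrite expRB ler_pdivlMr ?expR_gt0//; apply: le_trans h.
rewrite mulrC -ExZ; last first.
  by apply: tame_bool; apply: measurable_fun_ler => //; case: tZ.
apply: Ex_le => //.
  by apply: tameZ; apply: tame_bool; apply: measurable_fun_ler => //; case: tZ.
move=> v; case: (leP (expR y) (Zp n s e L (b * theta) v)) => h' /=; first by rewrite mulr1.
rewrite mulr0; exact: (Zp_ge0 n s n0 e se).
Qed.

End one_system.

(** * Numerical balances for one step of the descent *)

Section level_arith.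
Context {R : realType}.
Implicit Types F c V r h a b m x Q : R.

Lemma lower_level F c V : - (c * V) < F -> - (2 * c * V) <= F - c * V.
Proof. lra. Qed.

Lemma upper_level F c V : F <= c * V -> F + c * V <= 2 * c * V.
Proof. lra. Qed.

Lemma half_level F c V : F <= - (c * V) -> F + c / 2 * V <= - (c / 2 * V).
Proof. lra. Qed.

Lemma ten_levels c r : c <= r / 20 -> 10 * c - r <= - (r / 2).
Proof. lra. Qed.

Lemma pair_level (x0 : R) Q (p1 p2 p3 : R) : Q <= p1 + p2 + p3 ->
  p1 <= x0 / 16 -> p2 <= x0 / 16 -> p3 <= x0 / 8 -> Q <= x0 / 4.
Proof. lra. Qed.

(** The drift is at least [h a x0 / 4]; the condition on [h] limits the quadratic loss to
    [h a x0 / 8], and the condition on [c] keeps [2 c] below what remains. *)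
Lemma step_gain (x0 : R) m Q h a b c : 0 < h -> 0 < a -> 0 < x0 <= m -> a <= b ->
  h <= a * x0 / 2 -> c <= h * (a * x0) / 32 -> Q <= x0 / 4 ->
  2 * c < h * b / 2 * (m - x0 / 4 - Q) - h ^+ 2 / 4.
Proof.
move=> h0 a0 /andP[x00 x0m] ab ha c1 Qx.
have k0 : 0 < h * (a * x0) by rewrite !mulr_gt0.
have k1 : h * b / 2 * (x0 / 2) <= h * b / 2 * (m - x0 / 4 - Q).
  apply: ler_wpM2l; last lra.
  by rewrite divr_ge0// mulr_ge0 ?(ltW h0)// (le_trans (ltW a0)).
have k2 : h * a * x0 <= h * b * x0.
  by rewrite ler_wpM2r ?(ltW x00)// ler_wpM2l// ltW.
have k3 : h ^+ 2 <= h * (a * x0 / 2) by rewrite expr2 ler_wpM2l// ltW.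
lra.
Qed.

Lemma step_contradiction F V c (X Y : R) : V * (2 * c) < V * (X - Y / 4) ->
  - (c * V) < F -> c * V < F + V * X - V * Y / 4.
Proof. lra. Qed.

End level_arith.

(** * Asymptotics along a sequence of systems and descent over the overlap levels *)

Section family.
Context {R : realType} (S : nat -> spin_system R).
Hypothesis SV : forall i, ss_V R (S i) = i.+1%:R.
Context (b0 : R).
Hypothesis b0_gt0 : 0 < b0.
Hypothesis free0 : forall t : R, 0 < t ->
  \forall i \near \oo, - (t * i.+1%:R) <= freeZ (S i) b0.

Lemma rate_gt0 (t : R) : 0 < t -> 0 < rate b0 t.
Proof. by move=> t0; rewrite divr_gt0 ?exprn_gt0// mulr_gt0// exprn_gt0. Qed.

Lemma exp_near_le (A c eps : R) : 0 < c -> 0 < eps ->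
  \forall i \near \oo, A * expR (- (c * i.+1%:R)) <= eps.
Proof.
move=> c0 eps0; near=> i.
have iA : `|A| / (eps * c) <= i%:R by near: i; exact: nbhs_infty_ger.
have V0 : 0 <= c * i.+1%:R by rewrite mulr_ge0// ltW.
rewrite expRN ler_pdivrMr ?expR_gt0//.
apply: (@le_trans _ _ (eps * (1 + c * i.+1%:R))); last first.
  by rewrite ler_wpM2l ?(ltW eps0)// expR_ge1Dx.
apply: le_trans (ler_norm A) _.
move: iA; rewrite ler_pdivrMr ?mulr_gt0// => iA.
have : i%:R * (eps * c) <= i.+1%:R * (eps * c).
  by rewrite ler_wpM2r ?mulr_ge0 ?ltW// ltr_nat.
by rewrite -natr1 in V0 *; lra.
Unshelve. all: by end_near. Qed.

Lemma probZ_small (t : R) : 0 < t -> \forall i \near \oo, forall b, 0 < b <= b0 ->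
  probZ_le (S i) b (- (t * i.+1%:R)) <= expR (- (rate b0 (t / 2) * i.+1%:R)).
Proof.
move=> t0; near=> i => b bb0; rewrite -SV; apply: probZ_le_tail => //.
by rewrite SV; near: i; apply: free0; rewrite divr_gt0.
Unshelve. all: by end_near. Qed.

(** A large expected planted log-mass would, by concentration, make small values of [Zp] so rare
    that [mass_bound] fails. *)
Lemma freeZp_small (t : R) : 0 < t -> \forall i \near \oo, forall b, 0 < b <= b0 ->
  freeZp (S i) xpredT b <= t * i.+1%:R.
Proof.
move=> t0.
have t20 : 0 < t / 2 by rewrite divr_gt0.
have r0 := rate_gt0 _ t20.
have u0 : 0 < rate b0 (t / 2) / 2 by rewrite divr_gt0.
have w0 : 0 < rate b0 (rate b0 (t / 2) / 2 / 2) by apply: rate_gt0; rewrite divr_gt0.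
set r := rate b0 (t / 2) in r0 u0 w0 *.
near=> i.
have hZ : forall b, 0 < b <= b0 ->
    probZ_le (S i) b (- (r / 2 * i.+1%:R)) <= expR (- (rate b0 (r / 2 / 2) * i.+1%:R)).
  by near: i; exact: probZ_small.
have e1 : 1 * expR (- (rate b0 (r / 2 / 2) * i.+1%:R)) <= 1 / 4.
  by near: i; apply: exp_near_le => //; lra.
have e2 : 1 * expR (- (t / 2 * i.+1%:R)) <= 1 / 4.
  by near: i; apply: exp_near_le => //; lra.
have e3 : 1 * expR (- (r / 2 * i.+1%:R)) <= 1 / 4.
  by near: i; apply: exp_near_le => //; lra.
move=> b bb0; rewrite leNgt; apply/negP => big.
pose N : R := i.+1%:R; rewrite -/N in hZ e1 e2 e3 big *.
have N0 : 0 < N by rewrite ltr0n.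
(* The threshold for [Z] costs the factor [exp (r N / 2)], half of the rate [r] at which [Zp]
   concentrates. Each of the three terms is then at most 1/4, although their sum is at least 1. *)
have := mass_bound (S i) b (r / 2 * N) (t / 2 * N).
have h1 : probZ_le (S i) b (- (r / 2 * N)) <= 1 / 4.
  by apply: le_trans (hZ b bb0) _; rewrite -[leLHS]mul1r.
have h2 : expR (- (t / 2 * N)) <= 1 / 4 by rewrite -[leLHS]mul1r.
have h3 : expR (r / 2 * N) * probZp_le (S i) xpredT b (t / 2 * N) <= 1 / 4.
  apply: le_trans e3.
  have : probZp_le (S i) xpredT b (t / 2 * N) <= expR (- (r * N)).
    rewrite /N -SV; apply: probZp_le_tail => //; first by exists (ss_e R (S i)).
      exact: ltW.
    by rewrite SV -/N; lra.
  rewrite -(ler_pM2l (expR_gt0 (r / 2 * N))) => /le_trans; apply.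
  rewrite -expRD mul1r ler_expR; lra.
lra.
Unshelve. all: by end_near. Qed.

Context (a b1 : R).
Hypothesis a_gt0 : 0 < a.
Hypothesis b1_lt : b1 < b0.

(** The rank from which the bound holds does not depend on [b]; this uniformity is what finally
    gives one constant for the whole interval. *)
Definition exp_small (L : forall i, pred (ss_C R (S i))) :=
  exists A r : R, 0 < r /\ \forall i \near \oo, forall b, a <= b <= b1 ->
    mtail (S i) (L i) b <= A * expR (- (r * i.+1%:R)).

Definition lvl (m : R) i : pred (ss_C R (S i)) := fun c => m <= sov (S i) c.

Lemma exp_small_of_tail (L : forall i, pred (ss_C R (S i))) (y r : R) :
  0 < y -> 0 < r ->
  (\forall i \near \oo, forall b, a <= b <= b1 ->
    probZp_ge (S i) (L i) b (- (y * i.+1%:R)) <= expR (- (r * i.+1%:R))) ->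
  exp_small L.
Proof.
move=> y0 r0 hL.
(* The lower bound [exp (- u N)] on [Z] costs at most [exp (2 u N)]; a quarter of the smaller rate
   leaves both terms decaying. *)
pose u := Num.min y r / 4.
have u0 : 0 < u by rewrite divr_gt0// lt_min y0.
have uy : u * 4 <= y by rewrite /u divfK// ge_min lexx.
have ur : u * 4 <= r by rewrite /u divfK// ge_min lexx orbT.
pose w := rate b0 (u / 2).
have w0 : 0 < w by apply: rate_gt0; rewrite divr_gt0.
pose q := Num.min w u.
have q0 : 0 < q by rewrite lt_min w0.
have qw : q <= w by rewrite ge_min lexx.
have qu : q <= u by rewrite ge_min lexx orbT.
exists 3, q; split=> //; near=> i.
have hZ : forall b, 0 < b <= b0 ->
    probZ_le (S i) b (- (u * i.+1%:R)) <= expR (- (w * i.+1%:R)).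
  by near: i; exact: probZ_small.
have hLi : forall b, a <= b <= b1 ->
    probZp_ge (S i) (L i) b (- (y * i.+1%:R)) <= expR (- (r * i.+1%:R)).
  by near: i.
move=> b abb1; have /andP[ab bb1] := abb1.
pose N : R := i.+1%:R; rewrite -/N in hZ hLi *.
have N0 : 0 < N by rewrite ltr0n.
apply: le_trans (mtail_bound (S i) (L i) b (u * N) (- (y * N))) _.
have h1 : probZ_le (S i) b (- (u * N)) <= expR (- (q * N)).
  apply: (@le_trans _ _ (expR (- (w * N)))); last by rewrite ler_expR lerN2 ler_wpM2r ?(ltW N0).
  by apply: hZ; rewrite (lt_le_trans a_gt0 ab) (le_trans bb1)// ltW.
have h2 := hLi b abb1.
have h3 : expR (u * N) * expR (- (r * N)) <= expR (- (q * N)).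
  by rewrite -expRD ler_expR -mulNr -mulrDl -mulNr ler_wpM2r ?(ltW N0)//; lra.
have h4 : expR (u * N) * expR (- (y * N) + u * N) <= expR (- (q * N)).
  rewrite -expRD ler_expR (_ : _ + _ = (u * 2 - y) * N); last by ring.
  by rewrite -mulNr ler_wpM2r ?(ltW N0)//; lra.
have h5 : expR (u * N) * probZp_ge (S i) (L i) b (- (y * N)) <= expR (- (q * N)).
  by apply: le_trans h3; rewrite ler_wpM2l ?expR_ge0.
rewrite mulrDr; lra.
Unshelve. all: by end_near. Qed.

(** If the expected log-mass of the layer exceeded [- c N], concentration would bound [Zp] of the
    layer below by [exp (- 2 c N)], which makes the transfer to the original Gibbs measure possible.
    The layer must be nonempty: [ln] of an empty sum is not minus infinity. *)
Lemma freeZp_level_neg (x0 m : R) : 0 < x0 <= m ->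
  exp_small (lvl (m + x0 / 4)) ->
  exists2 c : R, 0 < c & \forall i \near \oo, forall b, a <= b <= b1 ->
    (exists u, lvl m i u) -> freeZp (S i) (lvl m i) b <= - (c * i.+1%:R).
Proof.
move=> /andP[x00 x0m] [A [r [r0 hA]]].
(* The first bound keeps [b + h <= b0], where the planted free energy is known to be small; the
   second makes the linear gain beat the quadratic loss. *)
pose h := Num.min (b0 - b1) (a * x0 / 2).
have ax0 : 0 < a * x0 by rewrite mulr_gt0.
have h0 : 0 < h by rewrite lt_min subr_gt0 b1_lt divr_gt0.
have hb : h <= b0 - b1 by rewrite ge_min lexx.
have ha : h <= a * x0 / 2 by rewrite ge_min lexx orbT.
have hax0 : 0 < h * (a * x0) by rewrite mulr_gt0.
(* The first bound is the one of [step_gain]. The second turns the transfer cost [exp (10 c N)] into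
   at most [exp (r N / 2)]. *)
pose c := Num.min (h * (a * x0) / 32) (r / 20).
have c0 : 0 < c by rewrite lt_min !divr_gt0.
have c1 : c <= h * (a * x0) / 32 by rewrite ge_min lexx.
have c2 : c <= r / 20 by rewrite ge_min lexx orbT.
have rho0 := rate_gt0 c c0.
exists c => //; near=> i.
have F1 : forall b, 0 < b <= b0 -> freeZp (S i) xpredT b <= c * i.+1%:R.
  by near: i; exact: freeZp_small.
have F2 : forall b, a <= b <= b1 ->
    mtail (S i) (lvl (m + x0 / 4) i) b <= A * expR (- (r * i.+1%:R)).
  by near: i.
have F3 : 1 * expR (- (rate b0 c * i.+1%:R)) <= x0 / 16.
  by near: i; apply: exp_near_le => //; rewrite divr_gt0.
have F4 : `|A| * expR (- (r / 2 * i.+1%:R)) <= x0 / 8.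
  by near: i; apply: exp_near_le; rewrite divr_gt0.
move=> b abb1 L0; have /andP[ab bb1] := abb1; rewrite leNgt; apply/negP => big.
have b_gt0 : 0 < b := lt_le_trans a_gt0 ab.
have bb0 : 0 < b <= b0 by rewrite b_gt0 (le_trans bb1)// ltW.
have bhb0 : 0 < b + h <= b0 by rewrite addr_gt0//= (le_trans (lerD bb1 hb))// addrC subrK.
have VN := SV i; have N0 : 0 < ss_V R (S i) by exact: ss_V_gt0.
rewrite -VN in F1 F2 F3 F4 big; move: F1 F2 F3 F4 big N0 => F1 F2 F3 F4 big N0.
have step := freeZp_step (S i) (lvl m i) (lvl (m + x0 / 4) i) m (x0 / 4) b h L0.
have pairb := mpair_bound (S i) (lvl m i) (lvl (m + x0 / 4) i) b
  (- (2 * c * ss_V R (S i))) (2 * c * ss_V R (S i)) L0.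
have p1 : probZp_le (S i) (lvl m i) b (- (2 * c * ss_V R (S i))) <= x0 / 16.
  apply: le_trans F3; rewrite mul1r; apply: probZp_le_tail => //; first exact: ltW.
  exact: lower_level big.
have p2 : probZp_ge (S i) xpredT b (2 * c * ss_V R (S i)) <= x0 / 16.
  apply: le_trans F3; rewrite mul1r; apply: probZp_ge_tail => //.
  - by exists (ss_e R (S i)).
  - exact: ltW.
  - exact: upper_level (F1 b bb0).
have p3 : expR (3 * (2 * c * ss_V R (S i)) - 2 * - (2 * c * ss_V R (S i))) *
    mtail (S i) (lvl (m + x0 / 4) i) b <= x0 / 8.
  apply: le_trans F4.
  apply: (@le_trans _ _ (expR (10 * c * ss_V R (S i)) *
     (`|A| * expR (- (r * ss_V R (S i)))))).
    apply: ler_pM; [exact: expR_ge0|exact: mtail_ge0| |].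
      by rewrite ler_expR le_eqVlt; apply/orP; left; apply/eqP; ring.
    apply: le_trans (F2 b abb1) _; rewrite ler_wpM2r ?expR_ge0//; exact: ler_norm.
  rewrite mulrCA -expRD ler_wpM2l// ler_expR.
  rewrite (_ : _ + _ = (10 * c - r) * ss_V R (S i)); last by ring.
  by rewrite -mulNr ler_wpM2r ?(ltW N0)//; exact: ten_levels.
set Q := mpair _ _ _ _ in step pairb.
have Qx : Q <= x0 / 4 := pair_level _ _ _ _ _ pairb p1 p2 p3.
have : freeZp (S i) (lvl m i) (b + h) <= c * ss_V R (S i).
  apply: le_trans (F1 _ bhb0); apply: freeZp_mono => //; by case/andP: bhb0.
apply/negP; rewrite -ltNge; apply: lt_le_trans (step _ _ _ _ _ _); first last.
- by [].
- by [].
- by rewrite divr_ge0// ltW.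
- exact: le_trans (ltW x00) x0m.
- by move=> u; rewrite /lvl -ltNge => /ltW.
- by [].
apply: step_contradiction big; rewrite ltr_pM2l//.
by apply: step_gain ab ha c1 Qx => //; rewrite x00.
Unshelve. all: by end_near. Qed.

Lemma exp_small_step (x0 m : R) : 0 < x0 <= m ->
  exp_small (lvl (m + x0 / 4)) -> exp_small (lvl m).
Proof.
move=> x0m /(freeZp_level_neg _ _ x0m)[c c0 hc].
have c20 : 0 < c / 2 by rewrite divr_gt0.
apply: (exp_small_of_tail _ (c / 2) (rate b0 (c / 2))) => //; first exact: rate_gt0.
near=> i.
have hi : forall b, a <= b <= b1 -> (exists u, lvl m i u) ->
    freeZp (S i) (lvl m i) b <= - (c * i.+1%:R) by near: i.
move=> b abb1; have /andP[ab bb1] := abb1.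
have b_gt0 : 0 < b := lt_le_trans a_gt0 ab.
have bb0 : 0 < b <= b0 by rewrite b_gt0 (le_trans bb1)// ltW.
have N0 := ss_V_gt0 R (S i); rewrite -SV in hi *.
case: (pselect (exists u, lvl m i u)) => [L0|noL].
  apply: probZp_ge_tail => //; first exact: ltW.
  by move: (hi b abb1 L0); set F := freeZp _ _ _ => hF; exact: half_level hF.
(* The layer is empty, so any [z] bounds its overlaps; this one makes the Markov bound equal to the
   target. *)
pose z := (- (c / 2 * ss_V R (S i)) - rate b0 (c / 2) * ss_V R (S i))
  / (b ^+ 2 * ss_V R (S i) / 2).
have h : forall u, lvl m i u -> sov (S i) u <= z.
  by move=> u Lu; case: noL; exists u.
apply: le_trans (probZp_ge_markov _ _ _ _ _ h) _.
rewrite /z mulrC divfK; last by rewrite gt_eqF// !mulr_gt0 ?exprn_gt0.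
by rewrite ler_expR le_eqVlt; apply/orP; left; apply/eqP; ring.
Unshelve. all: by end_near. Qed.

(** Induction on the number of steps of size [x0 / 4] needed to climb from [m] above 1, where layers
    are empty since overlaps are at most 1. *)
Lemma exp_small_lvl (x0 m : R) : 0 < x0 <= m -> exp_small (lvl m).
Proof.
move=> /andP[x00].
pose k := (Num.truncn (4 / x0)).+1.
have kb : 4 / x0 < k%:R by rewrite truncnS_gt.
have k1 : 1 < k%:R * (x0 / 4).
  by move: kb; rewrite ltr_pdivrMr//; lra.
have : 1 < x0 + k%:R * (x0 / 4) by lra.
move: k k1 kb => k _ _ km x0m; have {km} : 1 < m + k%:R * (x0 / 4) by lra.
elim: k m x0m => [|k IH] m x0m.
  rewrite mul0r addr0 => m1; exists 0, 1; split=> //; near=> i => b _.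
  rewrite mul0r mtail0// => u; rewrite /lvl -ltNge; apply: le_lt_trans m1.
  have := @ov_norm_le R _ _ (ss_s R (S i)) (ss_pm R (S i)) (ss_n_gt0 R (S i))
    (ss_e R (S i)) u.
  by move=> /(le_trans (ler_norm _)).
rewrite -natr1 => mk; apply: (exp_small_step x0); first by rewrite x00.
by apply: IH; lra.
Unshelve. all: by end_near. Qed.

Lemma exp_small_neg (x0 : R) : 0 < x0 ->
  exp_small (fun i => (fun u => sov (S i) u <= - x0) : pred _).
Proof.
(* At overlap at most [- x0] the planted first moment is below [exp (- 2 y N)], half of which is
   spent on the threshold. *)
move=> x00; pose y := a ^+ 2 * x0 / 4.
have y0 : 0 < y by rewrite divr_gt0// mulr_gt0// exprn_gt0.
apply: (exp_small_of_tail _ y y) => //; near=> i => b /andP[ab _].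
apply: le_trans (probZp_ge_markov _ _ _ (- x0) _ _) _ => //.
have N0 := ss_V_gt0 R (S i).
rewrite -SV ler_expR (_ : _ - _ = (y - b ^+ 2 * x0 / 2) * ss_V R (S i)); last by field.
rewrite -[leRHS]mulNr ler_wpM2r ?(ltW N0)//.
have : a ^+ 2 * x0 <= b ^+ 2 * x0.
  rewrite ler_wpM2r ?(ltW x00)// lerXn2r ?nnegrE ?(ltW a_gt0)//.
  exact: le_trans (ltW a_gt0) ab.
by rewrite /y; lra.
Unshelve. all: by end_near. Qed.

Lemma overlap_exp_small (x0 : R) : 0 < x0 ->
  exists2 K : R, 0 < K & forall i b, a <= b <= b1 ->
    mtail (S i) (fun u => x0 <= `|sov (S i) u|) b <= K * expR (- (i.+1%:R / K)).
Proof.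
move=> x00.
have x01 : 0 < x0 <= x0 by rewrite x00 lexx.
have [A [r [r0 h1]]] := exp_small_lvl x0 x0 x01.
have [A' [r' [r'0 h2]]] := exp_small_neg x0 x00.
have h12 : \forall i \near \oo, forall b, a <= b <= b1 ->
    mtail (S i) (fun u => x0 <= `|sov (S i) u|) b
    <= A * expR (- (r * i.+1%:R)) + A' * expR (- (r' * i.+1%:R)).
  near=> i.
  have g1 : forall b, a <= b <= b1 -> mtail (S i) (lvl x0 i) b
      <= A * expR (- (r * i.+1%:R)) by near: i.
  have g2 : forall b, a <= b <= b1 -> mtail (S i) (fun u => sov (S i) u <= - x0) b
      <= A' * expR (- (r' * i.+1%:R)) by near: i.
  move=> b ab; apply: le_trans (lerD (g1 b ab) (g2 b ab)).
  apply: mtailD => u; rewrite ler_normr /lvl => /orP[->//|]; rewrite lerNr => ->.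
  by rewrite orbT.
case: h12 => N0 _ hN0.
(* The last term absorbs the indices below [N0], where only [mtail <= 1] is known; there
   [(i + 1) / K <= N0] because [K >= 1]. *)
pose K := `|A| + `|A'| + r^-1 + r'^-1 + expR N0%:R.
have e0 : 1 <= expR N0%:R :> R by rewrite -expR0 ler_expR.
have ri : 0 < r^-1 by rewrite invr_gt0.
have r'i : 0 < r'^-1 by rewrite invr_gt0.
have A0 := normr_ge0 A; have A'0 := normr_ge0 A'.
have K1 : 1 <= K by rewrite /K; lra.
have K0 : 0 < K by lra.
exists K => // i b ab; have N1 : 0 <= i.+1%:R :> R by [].
case: (ltnP i N0) => iN.
  apply: le_trans (mtail_le1 _ _ _) _.
  apply: (@le_trans _ _ (expR N0%:R * expR (- N0%:R))).
    by rewrite -expRD subrr expR0.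
  apply: ler_pM; rewrite ?expR_ge0//; first by rewrite /K; lra.
  rewrite ler_expR lerN2 ler_pdivrMr//.
  have : i.+1%:R <= N0%:R :> R by rewrite ler_nat.
  by have : 0 <= N0%:R :> R by []; nra.
apply: le_trans (hN0 i iN b ab) _.
have cmp (t : R) : 0 < t -> t^-1 <= K -> expR (- (t * i.+1%:R)) <= expR (- (i.+1%:R / K)).
  move=> t0 tK; rewrite ler_expR lerN2 [leRHS]mulrC ler_wpM2l//.
  by rewrite -[t]invrK lef_pV2 ?posrE ?invr_gt0.
have g1 : A * expR (- (r * i.+1%:R)) <= `|A| * expR (- (i.+1%:R / K)).
  apply: (@le_trans _ _ (`|A| * expR (- (r * i.+1%:R)))).
    by rewrite ler_wpM2r ?expR_ge0// ler_norm.
  by rewrite ler_wpM2l//; apply: cmp => //; rewrite /K; lra.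
have g2 : A' * expR (- (r' * i.+1%:R)) <= `|A'| * expR (- (i.+1%:R / K)).
  apply: (@le_trans _ _ (`|A'| * expR (- (r' * i.+1%:R)))).
    by rewrite ler_wpM2r ?expR_ge0// ler_norm.
  by rewrite ler_wpM2l//; apply: cmp => //; rewrite /K; lra.
apply: le_trans (lerD g1 g2) _; rewrite -mulrDl ler_wpM2r ?expR_ge0//.
by rewrite /K; lra.
Unshelve. all: by end_near. Qed.

End family.

(** * The law of a finite family of couplings *)

Lemma eq_measure_rectangles d1 d2 (T1 : measurableType d1)
    (T2 : measurableType d2) (R : realType)
    (m1 m2 : {measure set (T1 * T2)%type -> \bar R}) :
  (m1 setT < +oo)%E ->
  (forall A B, measurable A -> measurable B -> m1 (A `*` B) = m2 (A `*` B)) ->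
  forall X, measurable X -> m1 X = m2 X.
Proof.
move=> m1T m12 X mX.
pose C : set (set (T1 * T2)) :=
  [set C | exists A, measurable A /\ exists B, measurable B /\ C = A `*` B].
have CI : setI_closed C.
  move=> /= _ _ [X1 [mX1 [X2 [mX2 ->]]]] [Y1 [mY1 [Y2 [mY2 ->]]]].
  rewrite -setXI; exists (X1 `&` Y1); split; first exact: measurableI.
  by exists (X2 `&` Y2); split => //; exact: measurableI.
apply: (measure_unique C (fun=> setT)) => //.
- rewrite measurable_prod_measurableType //; congr (<<s _ >>).
  rewrite predeqE; split => [[A mA [B mB <-]]|[A [mA [B [mB ->]]]]].
    by exists A; split => //; exists B.
  by exists A => //; exists B.
- by move=> n; exists setT; split => //; exists setT; split => //; rewrite setXTT.
- by rewrite bigcup_const.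
- by move=> A [A1 [mA1 [A2 [mA2 ->]]]]; exact: m12.
Qed.

Section law.
Context {d} {T : measurableType d} {R : realType} (P : probability T R)
  {I : choiceType} (g : I -> T -> R).

Fixpoint gvec (J : seq I) (w : T) : vec R (size J) :=
  match J return vec R (size J) with
  | [::] => tt
  | j :: J' => (g j w, gvec J' w)
  end.

Lemma crd_gvec i0 J w k : (k < size J)%N ->
  crd (size J) (gvec J w) k = g (nth i0 J k) w.
Proof. by elim: J k => // j J IH [|k] //= kJ; exact: IH. Qed.

Hypothesis iid : iid_std_gaussian P g.

Lemma measurable_gvec J : measurable_fun setT (gvec J).
Proof.
case: iid => mg _; elim: J => [|j J IH] /=; first exact: measurable_cst.
exact: measurable_fun_pair.
Qed.

Let evt (J : seq I) (B : I -> set R) : set T :=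
  \bigcap_(j in [set j | j \in J]) (g j @^-1` B j).

Let measurable_evt J B : (forall j, measurable (B j)) -> measurable (evt J B).
Proof.
case: iid => mg _ mB; apply: fin_bigcap_measurable; first exact: finite_seq.
by move=> j _; rewrite -[X in measurable X]setTI; exact: mg.
Qed.

Let prob_evt J B : uniq J -> (forall j, measurable (B j)) ->
  P (evt J B) = (\prod_(j <- J) stdnormal R (B j))%E.
Proof.
case: iid => _ [lg ig] uJ mB; rewrite /evt ig//.
by apply: eq_bigr => j _; rewrite lg.
Qed.

(** Independence is assumed on rectangles only. Keeping an event on the couplings [J0] in the
    statement lets the induction move one coupling at a time: on a rectangle [A1 x A2], the side
    [A1] joins the event through [B'], and the induction hypothesis treats [A2]. *)
Lemma prob_gvec_evt J J0 B A : uniq (J0 ++ J) -> (forall j, measurable (B j)) ->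
  measurable A ->
  P (evt J0 B `&` gvec J @^-1` A) = (P (evt J0 B) * gauss (size J) A)%E.
Proof.
elim: J J0 B A => [|j J IH] J0 B A uJ mB mA.
  rewrite /= diracE; case: (boolP (_ \in A)) => [/set_mem|/negP] tA.
    rewrite mule1 (_ : _ @^-1` A = setT) ?setIT//.
    by apply/seteqP; split.
  rewrite mule0 (_ : _ @^-1` A = set0) ?setI0//.
  by apply/seteqP; split => // w /= /mem_set.
have mE := measurable_evt J0 B mB.
pose m1 : {measure set (vec R (size (j :: J))) -> \bar R} :=
  measure_function_pushforward__canonical__measure_function_Measure
    (mrestr P mE) (measurable_gvec (j :: J)).
have Pfin : P (evt J0 B) \is a fin_num by exact: fin_num_measure.
have P0 : 0 <= fine (P (evt J0 B)) by exact: fine_ge0.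
pose m2 : {measure set (vec R (size (j :: J))) -> \bar R} :=
  mscale (NngNum P0) (gauss (size (j :: J))).
have -> : P (evt J0 B `&` gvec (j :: J) @^-1` A) = m1 A.
  by rewrite /m1 /= /pushforward /mrestr setIC.
have -> : (P (evt J0 B) * gauss (size (j :: J)) A)%E = m2 A.
  by rewrite /m2 /= /mscale /= fineK.
apply: (@eq_measure_rectangles _ _ R (vec R (size J)) R m1 m2) => //.
  apply: (@le_lt_trans _ _ 1%E); last exact: ltry.
  rewrite /m1 /= /pushforward /mrestr /= preimage_setT setTI.
  exact: probability_le1.
move=> A1 A2 mA1 mA2.
have jJ0 : j \notin J0.
  by move: uJ; rewrite uniq_catC /= mem_cat negb_or => /andP[/andP[]].
pose B' i := if i == j then A1 else B i.
have mB' i : measurable (B' i) by rewrite /B'; case: ifP.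
have uJ' : uniq (rcons J0 j ++ J) by rewrite cat_rcons.
have uR : uniq (rcons J0 j) by move: uJ'; rewrite cat_uniq => /and3P[].
have uJ0 : uniq J0 by move: uJ; rewrite cat_uniq => /and3P[].
have eB : evt (rcons J0 j) B' = evt J0 B `&` g j @^-1` A1.
  apply/seteqP; split => w.
    move=> h; split; last first.
      by have := h j; rewrite /= mem_rcons inE eqxx /B' eqxx; exact.
    move=> i /= iJ; have := h i; rewrite /= mem_rcons inE iJ orbT /B'.
    by case: eqP => [ij|_]; [move: jJ0; rewrite -ij iJ|exact].
  move=> [h1 h2] i /=; rewrite mem_rcons inE /B'; case: eqP => [->//|_] /= iJ.
  exact: h1.
have -> : m1 (A1 `*` A2) = P (evt (rcons J0 j) B' `&` gvec J @^-1` A2).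
  rewrite /m1 /= /pushforward /mrestr /= eB; congr (P _).
  by apply/seteqP; split => w /=; tauto.
rewrite IH// /m2 /= /mscale /= product_measure1E// fineK// muleA; congr (_ * _)%E.
rewrite !prob_evt// big_rcons /= {2}/B' eqxx; congr (_ * _)%E.
rewrite big_seq_cond [RHS]big_seq_cond; apply: eq_bigr => i; rewrite andbT => iJ.
by rewrite /B'; case: eqP => // ij; move: jJ0; rewrite -ij iJ.
Qed.

Lemma law_gvec J A : uniq J -> measurable A ->
  P (gvec J @^-1` A) = gauss (size J) A.
Proof.
move=> uJ mA; have := prob_gvec_evt J [::] (fun=> setT) A uJ (fun=> measurableT) mA.
rewrite (_ : evt _ _ = setT) ?setTI ?probability_setT ?mul1e//.
by apply/seteqP; split.
Qed.

Lemma integral_gvec J (f : vec R (size J) -> R) : uniq J -> tame (size J) f ->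
  (forall v, 0 <= f v) ->
  (\int[P]_w (f (gvec J w))%:E = (Ex (size J) f)%:E)%E.
Proof.
move=> uJ tf f0; rewrite Ex_EFin//.
apply: (@ge0_integral_image_measure _ _ _ _ _ P (gauss (size J)) (gvec J) (EFin \o f)).
- exact: measurable_gvec.
- by move=> A mA; exact: law_gvec.
- by apply/measurable_EFinP; case: tf.
- by [].
Qed.

End law.

(** * The p-spin model *)

Section pspin.
Context {R : realType} (p : nat) (p_gt0 : (0 < p)%N) (i : nat).
Local Notation N := i.+1.

Definition locidx := {ffun 'I_p -> 'I_N}.

(** A single infinite array serves all sizes; size [N] reads the entries whose indices are all below
    [N]. *)
Definition glob (f : locidx) : midx p := [ffun k => nat_of_ord (f k)].

Definition couplings : seq (midx p) := map glob (enum locidx).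

Lemma glob_inj : injective glob.
Proof.
move=> f f' /ffunP h; apply/ffunP => k; have := h k; rewrite !ffunE.
exact: val_inj.
Qed.

Lemma uniq_couplings : uniq couplings.
Proof. by rewrite map_inj_uniq ?enum_uniq//; exact: glob_inj. Qed.

Lemma size_couplings : size couplings = (N ^ p)%N.
Proof. by rewrite size_map -cardE card_ffun !card_ord. Qed.

Definition idx0 : locidx := [ffun=> ord0].

Definition pspin_s (c : config N) (k : nat) : R :=
  \prod_(l < p) spin c (nth idx0 (enum locidx) k l).

(** Product of spins, with [true] standing for +1. *)
Definition pspin_op (c t : config N) : config N := [ffun j => c j == t j].
Definition pspin_e : config N := [ffun=> true].

Definition pspin_theta : R := N%:R `^ (- ((p%:R - 1) / 2)) / Num.sqrt 2.

Lemma spin_pm (c : config N) j : (spin c j = 1 :> R) \/ (spin c j = -1 :> R).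
Proof. by rewrite /spin; case: (c j); [left|right]. Qed.

Lemma pspin_pm c k : (k < size couplings)%N -> pspin_s c k = 1 \/ pspin_s c k = -1.
Proof.
move=> _; rewrite /pspin_s; elim/big_rec: _ => [|l x _ hx]; first by left.
case: (spin_pm c (nth idx0 (enum locidx) k l)) => ->; case: hx => ->;
  rewrite ?mul1r ?mulN1r ?opprK; by [left|right].
Qed.

Lemma size_couplings_gt0 : (0 < size couplings)%N.
Proof. by rewrite size_couplings expn_gt0. Qed.

Lemma spin_op (c t : config N) j :
  spin (pspin_op c t) j = spin c j * spin t j :> R.
Proof.
by rewrite /spin ffunE; case: (c j); case: (t j); rewrite /= ?mulr1 ?mul1r ?mulrNN ?mulr1.
Qed.

Lemma pspin_s_op c t k : (k < size couplings)%N ->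
  pspin_s (pspin_op c t) k = pspin_s c k * pspin_s t k.
Proof.
by move=> _; rewrite /pspin_s -big_split; apply: eq_bigr => l _; rewrite spin_op.
Qed.

Lemma pspin_s_e k : (k < size couplings)%N -> pspin_s pspin_e k = 1.
Proof. by move=> _; rewrite /pspin_s big1// => l _; rewrite /spin ffunE. Qed.

Lemma pspin_opK c : involutive (pspin_op c).
Proof. by move=> t; apply/ffunP => j; rewrite !ffunE; case: (c j); case: (t j). Qed.

Lemma pspin_op_inv r c t : pspin_op (pspin_op r c) (pspin_op r t) = pspin_op c t.
Proof.
by apply/ffunP => j; rewrite !ffunE; case: (r j); case: (c j); case: (t j).
Qed.

Lemma pspin_theta_gt0 : 0 < pspin_theta.
Proof. by rewrite divr_gt0 ?powR_gt0// sqrtr_gt0. Qed.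

Lemma pspin_V_gt0 : 0 < N%:R :> R.
Proof. by rewrite ltr0n. Qed.

Lemma pspin_theta2 : pspin_theta ^+ 2 * (size couplings)%:R = N%:R / 2.
Proof.
rewrite size_couplings natrX exprMn exprVn sqr_sqrtr// mulrAC; congr (_ / _).
rewrite -[_ ^+ 2]powR_mulrn ?powR_ge0// -powRrM -[_ ^+ p]powR_mulrn//.
rewrite -powRD; last by apply/implyP => _; rewrite pnatr_eq0.
by rewrite (_ : _ + _ = 1) ?powRr1//; field.
Qed.

Definition pspin : spin_system R := SpinSystem R (size couplings) (config N)
  pspin_s pspin_op pspin_e pspin_theta N%:R pspin_pm size_couplings_gt0
  pspin_s_op pspin_s_e pspin_opK pspin_op_inv pspin_theta_gt0 pspin_V_gt0 pspin_theta2.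

Lemma sum_couplings (f : locidx -> R) :
  \sum_(k < size couplings) f (nth idx0 (enum locidx) k) = \sum_x f x.
Proof.
transitivity (\sum_(x <- enum locidx) f x); last by rewrite big_enum.
by rewrite (big_nth idx0) big_mkord /couplings size_map.
Qed.

(** Expanding the p-th power of the sum over sites gives the sum over all multi-indices of the
    products of spins. *)
Lemma ov_overlap c t : corr (size couplings) pspin_s c t = overlap c t ^+ p.
Proof.
rewrite /corr /overlap exprMn exprVn -natrX -size_couplings; congr (_ * _).
under eq_bigr do rewrite /pspin_s -big_split /=.
rewrite (sum_couplings (fun x => \prod_(l < p) (spin c (x l) * spin t (x l)))).
rewrite -(bigA_distr_bigA (fun=> fun j => spin c j * spin t j)) /=.
by rewrite prodr_const card_ord.
Qed.

Section disorder.
Context {d} {T : measurableType d} (g : midx p -> T -> R).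

Lemma hamiltonianE w c : hamiltonian p N g w c =
  N%:R `^ (- ((p%:R - 1) / 2)) * energy (size couplings) pspin_s c (gvec g couplings w).
Proof.
rewrite /hamiltonian /energy; congr (_ * _).
rewrite -(sum_couplings (fun x => g (glob x) w * \prod_(l < p) spin c (x l))).
apply: eq_bigr => k _; rewrite (crd_gvec g (glob idx0))// mulrC; congr (_ * g _ w).
have kN : (k < size (enum locidx))%N by rewrite -(size_map glob); exact: ltn_ord.
exact/esym/(nth_map idx0).
Qed.

Lemma gibbs_weightE beta w c : gibbs_weight p N g beta w c =
  expR (beta * pspin_theta * energy (size couplings) pspin_s c (gvec g couplings w)).
Proof.
by rewrite /gibbs_weight hamiltonianE /pspin_theta; congr expR; ring.
Qed.

(** The constant factor of [wnull] cancels in the Gibbs ratio, and raising to the power [p]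
    preserves the order of nonnegative numbers. *)
Lemma gibbs_overlap_tailE beta eps w : 0 < eps ->
  gibbs_overlap_tail p N g beta eps w =
  otail (size couplings) pspin_s pspin_op
    (fun u => eps ^+ p <= `|corr (size couplings) pspin_s pspin_e u|)
    (beta * pspin_theta) (gvec g couplings w).
Proof.
move=> eps0; set v := gvec g couplings w; set x := beta * pspin_theta.
pose E c := expR (x * energy (size couplings) pspin_s c v).
have gE f : gibbs (size couplings) pspin_s (wnull (size couplings) x) x f v =
    (\sum_c E c * f c) / \sum_c E c.
  rewrite /gibbs /wsum /wnull; set K := card_inv * expR _.
  have K0 : K != 0.
    by rewrite gt_eqF// mulr_gt0 ?expR_gt0//; exact: (@card_inv_gt0 R _ pspin_e).
  under eq_bigr do rewrite -mulrA.
  by rewrite -!mulr_sumr -mulf_div divff// mul1r.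
rewrite /otail /gibbs2 gE /gibbs_overlap_tail.
under [X in _ = X / _]eq_bigr => c _ do rewrite gE mulrA.
rewrite -mulr_suml -mulrA -invfM -expr2.
have -> : \sum_s gibbs_weight p N g beta w s = \sum_c E c.
  by apply: eq_bigr => c _; rewrite gibbs_weightE.
congr (_ / _); apply: eq_bigr => c _; rewrite mulr_sumr; apply: eq_bigr => t _.
rewrite !gibbs_weightE -/v -/x -/(E c) -/(E t).
have -> : (eps ^+ p <= `|corr (size couplings) pspin_s pspin_e (pspin_op c t)|) =
    (eps <= `|overlap c t : R|).
  rewrite -(ov_op (size couplings) pspin_s pspin_op pspin_e pspin_s_op pspin_s_e).
  by rewrite ov_overlap normrX ler_pXn2r// nnegrE ?normr_ge0 ltW.
by case: (eps <= `|overlap c t|) => /=; ring.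
Qed.

Lemma free_energyE beta w : ln (Z (size couplings) pspin_s (beta * pspin_theta)
    (gvec g couplings w)) = N%:R * (free_energy p N g beta w - beta ^+ 2 / 4).
Proof.
rewrite /free_energy mulrBr mulVKf ?pnatr_eq0//.
have cC : card_inv (R := R) (C := config N) = 2 ^- N.
  by rewrite /card_inv card_ffun card_bool card_ord natrX.
have e2 : (beta * pspin_theta) ^+ 2 * (size couplings)%:R / 2 = N%:R * (beta ^+ 2 / 4).
  have -> : (beta * pspin_theta) ^+ 2 * (size couplings)%:R / 2 = beta ^+ 2 / 2 * (pspin_theta ^+ 2 * (size couplings)%:R) by ring.
  by rewrite pspin_theta2; field.
have S0 : 0 < \sum_(s : config N) 2 ^- N * gibbs_weight p N g beta w s.
  rewrite (bigD1 pspin_e)//= ltr_pwDl//.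
    by rewrite mulr_gt0 ?expR_gt0// invr_gt0 exprn_gt0.
  by apply: sumr_ge0 => c _; rewrite mulr_ge0 ?expR_ge0// invr_ge0 exprn_ge0.
rewrite -[X in _ - X]expRK -ln_div ?posrE ?expR_gt0//; congr ln.
rewrite /Z /wsum mulr_suml; apply: eq_bigr => c _.
by rewrite /wnull gibbs_weightE cC e2 expRN; ring.
Qed.

End disorder.
End pspin.

Lemma near_succ (Q : nat -> Prop) :
  (\forall i \near \oo, Q i) -> \forall i \near \oo, Q i.+1.
Proof. by case=> N _ hN; exists N => // i /= Ni; apply: hN => /=; exact: leqW. Qed.

Lemma half_drop (R : realType) (A t V : R) : A < - (t * V) ->
  A + t / 2 * V <= - (t / 2 * V).
Proof. lra. Qed.

Section main.
Context {R : realType} {d : measure_display} {T : measurableType d}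
  (P : probability T R) (p : nat) (g : midx p -> T -> R) (b0 : R).
Hypothesis iid : iid_std_gaussian P g.
Hypothesis b0_gt0 : 0 < b0.
Hypothesis cvgF :
  {ae P, forall w, free_energy p n g b0 w @[n --> \oo] --> b0 ^+ 2 / 4}.

(** The hypothesis is almost sure, the conclusion in mean. Dominated convergence is applied to the
    indicators of [Z >= exp (- t N / 2)], whose probability tends to 1; a mean below [- t N] would
    make it exponentially small by concentration. *)
Lemma freeZ_near (t : R) : 0 < t ->
  \forall i \near \oo, - (t * i.+1%:R) <= freeZ (pspin p i) b0.
Proof.
move=> t0.
pose n i := size (couplings p i).
pose f i (v : vec R (n i)) : R := (expR (- (t / 2 * i.+1%:R))
   <= Z (n i) (pspin_s p i) (b0 * pspin_theta p i) v)%R%:R.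
have tf i : tame (n i) (f i).
  apply: tame_bool; apply: measurable_fun_ler => //.
  exact: (@measurable_Z R _ _ (pspin_s p i)).
have fi0 i v : 0 <= f i v by [].
have Ef i : (\int[P]_w (f i (gvec g (couplings p i) w))%:E = (Ex (n i) (f i))%:E)%E.
  exact: (integral_gvec P g iid _ (f i) (uniq_couplings p i) (tf i) (fi0 i)).
have mf i : measurable_fun setT (fun w => (f i (gvec g (couplings p i) w))%:E).
  apply/measurable_EFinP; apply: measurableT_comp; first by case: (tf i).
  exact: (measurable_gvec P g iid).
have cvg1 : {ae P, forall w, setT w ->
    (fun i => (f i (gvec g (couplings p i) w))%:E) @ \oo --> 1%E}.
  apply: filterS cvgF => w cw _.
  apply: cvg_near_cst; near=> i.
  rewrite /f (_ : (expR _ <= _) = true)//.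
  rewrite -ler_ln ?posrE ?expR_gt0//; last exact: (Z_gt0 _ _ (pspin_e i)).
  rewrite expRK free_energyE [t / 2 * _]mulrC -mulrN ler_wpM2l//.
  suff : b0 ^+ 2 / 4 - t / 2 <= free_energy p i.+1 g b0 w by lra.
  near: i; apply: (near_succ (fun j => is_true (b0 ^+ 2 / 4 - t / 2 <= free_energy p j g b0 w))).
  have t20 : 0 < t / 2 by rewrite divr_gt0.
  move/cvgrPdist_le : cw => /(_ _ t20); apply: filterS => j.
  by rewrite ler_norml => /andP[_]; lra.
have int1 : P.-integrable setT (cst 1%E : T -> \bar R).
  exact: finite_measure_integrable_cst.
have bnd : {ae P, forall w j, setT w ->
    (`|(f j (gvec g (couplings p j) w))%:E| <= cst 1 w)%E}.
  apply: aeW => w j _; rewrite /= lee_fin /f.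
  by case: (expR _ <= _); rewrite /= ?normr1 ?normr0 ?ler01 ?lexx.
have [_ _] := dominated_convergence measurableT mf (measurable_cst (1%E : \bar R)) cvg1 int1 bnd.
have i1 : (\int[P]_w (cst 1 w) = 1 :> \bar R)%E.
  by rewrite integral_cst//= probability_setT mule1.
rewrite i1 => cE.
have {}cE : (fun i => Ex (n i) (f i)) @ \oo --> (1 : R).
  rewrite (_ : (fun i => _) =
      (fun i => fine (\int[P]_w (f i (gvec g (couplings p i) w))%:E)%E)).
    exact: fine_cvg cE.
  by apply/funext => i; rewrite Ef.
have h0 : 0 < 1 / 2 :> R by lra.
near=> i.
have E1 : 1 / 2 < Ex (n i) (f i).
  near: i; move/cvgrPdist_lt : cE => /(_ _ h0); apply: filterS => j.
  by rewrite ltr_norml => /andP[_]; lra.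
have e1 : 1 * expR (- (rate b0 (t / 2) * i.+1%:R)) <= 1 / 2.
  near: i; apply: exp_near_le => //; apply: rate_gt0 => //; by rewrite divr_gt0.
rewrite leNgt; apply/negP => big.
have : Ex (n i) (f i) <= expR (- (rate b0 (t / 2) * i.+1%:R)).
  apply: (Sw_upper_tail (n i) (pspin_s p i) (pspin_pm p i) (pspin_theta p i) i.+1%:R b0
    (pspin_theta_gt0 p i) (pspin_V_gt0 i) (pspin_theta2 p i) b0_gt0 _ b0 (t / 2)).
  - exact: (@wnull_weights R _ _ (pspin_e i)).
  - by rewrite b0_gt0 lexx.
  - by rewrite divr_ge0// ltW.
  - exact: half_drop big.
by move: E1 e1; rewrite mul1r; lra.
Unshelve. all: by end_near. Qed.

End main.

Theorem mainTheorem8 (R : realType) (d : measure_display) (T : measurableType d)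
  (P : probability T R) (p : nat) (g : midx p -> T -> R) (F : R -> R)
  (a b : R) :
  (2 <= p)%N ->
  iid_std_gaussian P g ->
  (forall beta : R, 0 < beta ->
     {ae P, forall w, free_energy p n g beta w @[n --> \oo] --> F beta}) ->
  0 < a -> a < b -> b < beta_crit F ->
  forall eps : R, 0 < eps ->
  exists K : R, 0 < K /\
    forall beta : R, a <= beta <= b ->
    forall N : nat, (1 <= N)%N ->
      (\int[P]_w (gibbs_overlap_tail p N g beta eps w)%:E
        <= (K * expR (- (N%:R / K)))%:E)%E.
Proof.
move=> p2 iid cvgF a0 ab bcrit eps eps0.
have p0 : (0 < p)%N by exact: ltnW.
(* The supremum has elements of the set above [b]; for an empty set [sup] takes the default value 0,
   which is not above [b]. *)
have [b0 [b00 Fb0] bb0] : exists2 b0, RS_set F b0 & b < b0.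
  have [RS0|RS0] := pselect (RS_set F !=set0); first exact: sup_gt.
  have := bcrit; rewrite /beta_crit sup_out; last by move=> [].
  by move=> b0; have := lt_trans (lt_trans a0 ab) b0; rewrite ltxx.
have cvgb0 : {ae P, forall w, free_energy p n g b0 w @[n --> \oo] --> b0 ^+ 2 / 4}.
  by rewrite -Fb0; exact: cvgF.
have [K K0 hK] := overlap_exp_small (fun i => @pspin R p i) (fun=> erefl) b0 b00
  (freeZ_near P p g b0 iid b00 cvgb0) a b a0 bb0 (eps ^+ p) (exprn_gt0 p eps0).
exists K; split=> // beta betab [//|i] _.
have := hK i beta betab.
rewrite -lee_fin; apply: le_trans.
rewrite /mtail -(integral_gvec P g iid (couplings p i)).
- by under eq_integral do rewrite (gibbs_overlap_tailE p p0)//.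
- exact: uniq_couplings.
- exact: (@tame_otail R _ _ _ _ (pspin_e i)).
- by move=> v; exact: (@otail_ge0 R _ _ _ _ (pspin_e i)).
Qed.
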